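(* Let $p\ge 2$, $\gamma>0$, and let $\mu$ be an Ising model on $\{-1,1\}^p$ with $\ell_1$-width at most $\gamma$. Let $0<\epsilon\le 4\gamma$ and $\delta\in(0,1)$. Set \[ d=\left\lceil \frac{3\gamma+\log\!\big(\tfrac{16\gamma(1+\gamma)}{\epsilon^2}\big)}{W\!\Big(\tfrac{3}{e}+\tfrac{1}{\gamma e}\log\!\big(\tfrac{16\gamma(1+\gamma)}{\epsilon^2}\big)\Big)}\right\rceil-1, \qquad T=\left\lceil\frac{576\,p\,\gamma^2e^{8\gamma}(1+\gamma)^2}{\epsilon^4}\right\rceil,\qquad \eta=\frac{2\gamma e^{-\gamma}}{3\sqrt{pT}}, \] \[ n=\left\lceil 2^7e^{8\gamma}\gamma^2(1+\gamma)^2\,\frac{(d+2)\log(ep)+\log\!\big(\tfrac{2p(d+2)}{\delta}\big)}{\epsilon^4}\right\rceil , \] where $W$ is the principal branch of the Lambert $W$ function, and assume $d+2\le p$. Suppose Algorithm 1 is run with these parameters and with moment estimates of order $d+2-(d\bmod 2)$ from $n$ observations. Then for each $u\in[p]$, with probability at least $1-\delta$, its output satisfies \[ \max_{v\ne u}|\hat\theta_{u,v}-\theta^*_{u,v}|\le\epsilon . \]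
   Context: Ising model: for $p\ge2$, a distribution on $\{-1,1\}^p$ of the form $\mu(\underline\sigma)\propto\exp\big(\sum_{\{u,v\}}\theta^*_{u,v}\sigma_u\sigma_v+\sum_{u\in[p]}\theta^*_u\sigma_u\big)$, where the first sum runs over unordered pairs of distinct indices and the couplings are symmetric, $\theta^*_{u,v}=\theta^*_{v,u}$. It has $\ell_1$-width at most $\gamma$ if $\sum_{v\ne u}|\theta^*_{u,v}|+|\theta^*_u|\le\gamma$ for every $u\in[p]$. For a node $u$, the local parameter vector is $\underline\theta_u=(\theta_u,(\theta_{u,v})_{v\ne u})\in\mathbb R^p$ (true value $\underline\theta^*_u=(\theta^*_u,(\theta^*_{u,v})_{v\ne u})$), and the local energy is $E_u(\underline\sigma;\underline\theta_u)=\sigma_u\big(\theta_u+\sum_{v\ne u}\theta_{u,v}\sigma_v\big)$. Moment estimates: for $K\subseteq[p]$ let $\sigma_K=\prod_{i\in K}\sigma_i$ ($\sigma_\emptyset=1$). Moment estimates of order $m$ from $n$ observations are numbers $\{\hat m_K:K\subseteq[p],|K|\le m\}$, each $\hat m_K$ being the empirical average of $\sigma_K$ over $n$ i.i.d. samples from $\mu$ (different sets $K$ may use different samples). For a polynomial $q$ in $\sigma_1,\dots,\sigma_p$ whose multilinear reduction (using $\sigma_i^2=1$) is $\sum_K c_K\sigma_K$ with all $|K|\le m$, set $\hat{\mathbb E}[q]=\sum_K c_K\hat m_K$. $P_d(x)=\sum_{k=0}^d\frac{(-x)^k}{k!}$. Algorithm 1: input $d,\gamma,\eta,T$ and moment estimates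 of order $d+2-(d\bmod 2)$. For each $u\in[p]$, define the approximate gradient $\tilde g(\underline\theta_u)\in\mathbb R^p$ by $\tilde g_u(\underline\theta_u)=-\hat{\mathbb E}[\sigma_uP_d(E_u(\underline\sigma;\underline\theta_u))]$ (coordinate of $\theta_u$) and $\tilde g_v(\underline\theta_u)=-\hat{\mathbb E}[\sigma_u\sigma_vP_d(E_u(\underline\sigma;\underline\theta_u))]$ for $v\ne u$ (coordinate of $\theta_{u,v}$); all multilinear monomials arising have at most $d+2-(d\bmod2)$ variables. Starting from $\underline\theta^{(1)}=0$, iterate $\underline\theta^{(t+1)}=\Pi\big(\underline\theta^{(t)}-\eta\,\tilde g(\underline\theta^{(t)})\big)$ for $t=1,\dots,T$, where $\Pi$ is the Euclidean projection onto $\{x\in\mathbb R^p:\|x\|_1\le\gamma\}$, and output $\hat{\underline\theta}_u=\frac1T\sum_{t=1}^T\underline\theta^{(t)}$, whose coordinates are denoted $(\hat\theta_u,(\hat\theta_{u,v})_{v\ne u})$. *)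

(* Defs.v *)
From HB Require Import structures.
From mathcomp Require Import all_boot all_order all_algebra.
From mathcomp Require Import all_classical all_reals all_analysis.
Set Implicit Arguments. Unset Strict Implicit. Unset Printing Implicit Defensive.
Import Order.TTheory GRing.Theory Num.Theory.
Local Open Scope classical_set_scope.
Local Open Scope ring_scope.

Section Ising.
Variable R : realType.
Variable p : nat.

Definition config := {ffun 'I_p -> bool}.
Definition spin (s : config) (i : 'I_p) : R := if s i then 1 else -1.
Definition sigmaK (K : {set 'I_p}) (s : config) : R := \prod_(i in K) spin s i.

Definition ising_H (th : 'I_p -> 'I_p -> R) (h : 'I_p -> R) (s : config) : R :=
  \sum_(u < p) \sum_(v < p | (u < v)%N) th u v * spin s u * spin s v
  + \sum_(u < p) h u * spin s u.

Definition ising_mu (th : 'I_p -> 'I_p -> R) (h : 'I_p -> R) (s : config) : R :=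
  expR (ising_H th h s) / \sum_(s' : config) expR (ising_H th h s').

Definition l1_width_le (th : 'I_p -> 'I_p -> R) (h : 'I_p -> R) (gamma : R) : Prop :=
  forall u : 'I_p, \sum_(v < p | v != u) `|th u v| + `|h u| <= gamma.

(* Multilinear polynomials in sigma_1..sigma_p: coefficient c_K of sigma_K. *)
Definition mlpoly := {ffun {set 'I_p} -> R}.
Definition symdiff (A B : {set 'I_p}) : {set 'I_p} := (A :\: B) :|: (B :\: A).
Definition mlX (K : {set 'I_p}) : mlpoly := [ffun J => (J == K)%:R].
Definition mladd (f g : mlpoly) : mlpoly := [ffun K => f K + g K].
Definition mlscale (c : R) (f : mlpoly) : mlpoly := [ffun K => c * f K].
(* product followed by multilinear reduction sigma_i^2 = 1 *)
Definition mlmul (f g : mlpoly) : mlpoly :=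
  [ffun K => \sum_(A : {set 'I_p}) \sum_(B : {set 'I_p} | symdiff A B == K) f A * g B].
Definition mlzero : mlpoly := [ffun _ => 0].
Definition mlpow (f : mlpoly) (k : nat) : mlpoly := iter k (mlmul f) (mlX (finset.set0)).

(* local energy E_u(sigma; x) = sigma_u (x_u + sum_{v<>u} x_v sigma_v), as a polynomial;
   the coordinate u of x is theta_u, the coordinate v <> u is theta_{u,v} *)
Definition Epoly (u : 'I_p) (x : 'I_p -> R) : mlpoly :=
  mlmul (mlX [set u])
    (foldr mladd (mlscale (x u) (mlX (finset.set0)))
       [seq mlscale (x v) (mlX [set v]) | v <- enum 'I_p & v != u]).

Definition Pd (d : nat) (f : mlpoly) : mlpoly :=
  foldr mladd mlzero
    [seq mlscale ((-1) ^+ k / (k`!)%:R) (mlpow f k) | k <- iota 0 d.+1].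

Definition hatE (m : nat) (mhat : {set 'I_p} -> R) (q : mlpoly) : R :=
  \sum_(K : {set 'I_p} | (#|K| <= m)%N) q K * mhat K.

Definition moment_order (d : nat) : nat := (d.+2 - odd d)%N.

Definition approx_grad (d : nat) (mhat : {set 'I_p} -> R) (u : 'I_p)
    (x : {ffun 'I_p -> R}) : {ffun 'I_p -> R} :=
  [ffun v => - hatE (moment_order d) mhat
                (mlmul (if v == u then mlX [set u] else mlX [set u; v])
                       (Pd d (Epoly u x)))].

Definition l1norm (x : {ffun 'I_p -> R}) : R := \sum_i `|x i|.
Definition sqdist (x y : {ffun 'I_p -> R}) : R := \sum_i (x i - y i) ^+ 2.

Definition proj_l1 (gamma : R) (x : {ffun 'I_p -> R}) : {ffun 'I_p -> R} :=
  xget [ffun _ => 0]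
    [set y | l1norm y <= gamma /\
             forall z, l1norm z <= gamma -> sqdist x y <= sqdist x z].

(* theta^(k+1) in the paper's numbering: iterate k times from 0 *)
Definition alg1_iterate (d : nat) (gamma eta : R) (mhat : {set 'I_p} -> R) (u : 'I_p)
    (k : nat) : {ffun 'I_p -> R} :=
  iter k (fun th : {ffun 'I_p -> R} => proj_l1 gamma
                      [ffun i => th i - eta * approx_grad d mhat u th i])
       [ffun _ => 0].

Definition alg1_output (d : nat) (gamma eta : R) (T : nat) (mhat : {set 'I_p} -> R)
    (u : 'I_p) : {ffun 'I_p -> R} :=
  [ffun i => (T%:R)^-1 * \sum_(k < T) alg1_iterate d gamma eta mhat u k i].

Definition emp_moments (n : nat) {T : Type} (X : {set 'I_p} -> 'I_n -> T -> config)
    (w : T) : {set 'I_p} -> R :=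
  fun K => (n%:R)^-1 * \sum_(j < n) sigmaK K (X K j w).

End Ising.

(* Principal branch of Lambert W: the unique w >= -1 with w e^w = x (x >= -1/e). *)
Definition LambertW {R : realType} (x : R) : R :=
  xget 0 [set w : R | -1 <= w /\ w * expR w = x].

Definition iid_samples {R : realType} {p n : nat} {dsp : measure_display}
    {Omega : measurableType dsp} (P : probability Omega R)
    (Y : 'I_n -> Omega -> config p) (mu : config p -> R) : Prop :=
  (forall j s, measurable (Y j @^-1` [set s])) /\
  (forall s : 'I_n -> config p,
      P [set w | forall j, Y j w = s j] = (\prod_(j < n) mu (s j))%:E).

(* Main.v *)
(* The interaction screening objective [S_u(x) = E exp(- E_u(sigma; x))] is convex, and
   its gradient vanishes at the true local parameters because [mu(s) exp(- E_u(s))] does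
   not depend on [s_u].  On the l1-ball of radius [gamma] it grows quadratically around
   that point, with constant [e^(-3 gamma) / (2 (1 + gamma))] in each coupling, since the
   conditional variance of a spin is at least [e^(-2 gamma)].  The approximate gradient
   differs from the gradient by the Taylor remainder of [exp], which the Lambert function
   makes small, and by a moment error which Hoeffding's inequality and a union bound over
   the sets [K] control.  With [B = eps^2 e^(-3 gamma) / (1 + gamma)], projected gradient
   descent contributes at most [B / 16] to the suboptimality of the averaged iterate, the
   remainder [3 B / 16] and the moments [B / 4]; the total [B / 2] is what the quadratic
   growth converts into an error of at most [eps]. *)
Require Import Defs.
From HB Require Import structures.
From mathcomp Require Import all_boot all_order all_algebra.
From mathcomp Require Import all_classical all_reals all_analysis.
From mathcomp Require Import ring lra.
Set Implicit Arguments. Unset Strict Implicit. Unset Printing Implicit Defensive.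
Import Order.TTheory GRing.Theory Num.Theory.
Import numFieldNormedType.Exports.
Local Open Scope classical_set_scope.
Local Open Scope ring_scope.

(** * Multilinear polynomials *)

(** A polynomial is a coefficient vector; expectations under the measure involve its values, whereas
    [hatE] sees only its coefficients. *)
Definition mleval {R : realType} {p : nat} (f : mlpoly R p) (s : config p) : R :=
  \sum_K f K * sigmaK R K s.

(** Dual to the sup norm on moment estimates: it bounds how much a uniform moment error is amplified
    by [hatE]. *)
Definition mlnorm {R : realType} {p : nat} (f : mlpoly R p) : R := \sum_K `|f K|.

(** The partial derivative of the local energy in coordinate [v]; the case [v = u] puts field and
    couplings into one linear form. *)
Definition tau {R : realType} {p : nat} (u v : 'I_p) (s : config p) : R :=
  spin R s u * (if v == u then 1 else spin R s v).

Definition energy {R : realType} {p : nat} (u : 'I_p) (x : 'I_p -> R) (s : config p) : R :=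
  \sum_v x v * tau u v s.

Section Multilinear.
Context {R : realType} {p : nat}.
Implicit Types (f g : mlpoly R p) (s : config p) (u v : 'I_p) (K : {set 'I_p}).

Lemma spin_sqr s u : spin R s u * spin R s u = 1.
Proof. by rewrite /spin; case: (s u); rewrite ?mulrNN mulr1. Qed.

Lemma normr_spin s u : `|spin R s u| = 1.
Proof. by rewrite /spin; case: (s u); rewrite ?normrN normr1. Qed.

Lemma normr_tau u v s : `|tau u v s : R| = 1.
Proof. by rewrite /tau; case: ifP => _; rewrite ?mulr1 ?normrM !normr_spin ?mulr1. Qed.

(** Spins indexed by both [A] and [B] occur twice and square to 1. *)
Lemma sigmaK_symdiff A B s : sigmaK R (symdiff A B) s = sigmaK R A s * sigmaK R B s.
Proof.
rewrite /sigmaK ![\prod_(i in _) _]big_mkcond /= -big_split /=.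
apply: eq_bigr => i _; rewrite /symdiff !inE.
by case: (i \in A); case: (i \in B); rewrite /= ?spin_sqr ?mulr1 ?mul1r.
Qed.

Lemma normr_sigmaK K s : `|sigmaK R K s| = 1.
Proof.
by rewrite /sigmaK normr_prod big1 // => i _; rewrite normr_spin.
Qed.

Lemma mleval_mul f g s : mleval (mlmul f g) s = mleval f s * mleval g s.
Proof.
rewrite /mleval big_distrlr /=.
under eq_bigr do rewrite ffunE big_distrl /=.
rewrite exchange_big /=; apply: eq_bigr => A _.
under eq_bigr do rewrite big_distrl /= big_mkcond.
rewrite exchange_big /=; apply: eq_bigr => B _.
rewrite (bigD1 (symdiff A B)) //= eqxx big1 ?addr0.
  by rewrite sigmaK_symdiff mulrACA.
by move=> K; rewrite eq_sym => /negbTE ->.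
Qed.

Lemma mleval_add f g s : mleval (mladd f g) s = mleval f s + mleval g s.
Proof.
by rewrite /mleval -big_split; apply: eq_bigr => K _; rewrite ffunE mulrDl.
Qed.

Lemma mleval_scale c f s : mleval (mlscale c f) s = c * mleval f s.
Proof.
by rewrite /mleval mulr_sumr; apply: eq_bigr => K _; rewrite ffunE mulrA.
Qed.

Lemma mleval_X K s : mleval (mlX R K) s = sigmaK R K s.
Proof.
rewrite /mleval (bigD1 K) //= big1 ?addr0 ?ffunE ?eqxx ?mul1r // => J /negbTE JK.
by rewrite ffunE JK mul0r.
Qed.

Lemma mleval_zero s : mleval (mlzero R p) s = 0.
Proof. by rewrite /mleval big1 // => K _; rewrite ffunE mul0r. Qed.

Lemma sigmaK_set0 s : sigmaK R finset.set0 s = 1.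
Proof. by rewrite /sigmaK big_set0. Qed.

Lemma sigmaK_set1 u s : sigmaK R [set u]%SET s = spin R s u.
Proof. by rewrite /sigmaK big_set1. Qed.

Lemma mleval_pow f k s : mleval (mlpow f k) s = mleval f s ^+ k.
Proof.
elim: k => [|k IH]; first by rewrite mleval_X sigmaK_set0.
by rewrite /mlpow iterS mleval_mul -/(mlpow f k) IH exprS.
Qed.

Lemma mleval_foldr {I : Type} (F : I -> mlpoly R p) f0 r s :
  mleval (foldr (@mladd R p) f0 (map F r)) s = \sum_(i <- r) mleval (F i) s + mleval f0 s.
Proof.
elim: r => [|a r IH] /=; first by rewrite big_nil add0r.
by rewrite mleval_add IH big_cons addrA.
Qed.

Lemma mleval_Epoly u (x : 'I_p -> R) s : mleval (Epoly u x) s = energy u x s.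
Proof.
rewrite /Epoly mleval_mul mleval_X sigmaK_set1 mleval_foldr.
rewrite mleval_scale mleval_X sigmaK_set0 mulr1.
rewrite big_filter big_enum_cond /= mulrDr big_distrr /= /energy.
rewrite [RHS](bigD1 u) //= addrC; congr (_ + _).
  apply: eq_bigr => v /negbTE vu.
  by rewrite mleval_scale mleval_X sigmaK_set1 /tau vu mulrCA.
by rewrite /tau eqxx mulr1 mulrC.
Qed.

Lemma mleval_Pd d f s :
  mleval (Pd d f) s = \sum_(k < d.+1) (- mleval f s) ^+ k / (k`!)%:R.
Proof.
rewrite /Pd mleval_foldr mleval_zero addr0 -[iota 0 d.+1]/(index_iota 0 d.+1) big_mkord.
apply: eq_bigr => k _.
by rewrite mleval_scale mleval_pow [in RHS]exprNn mulrAC.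
Qed.

Lemma mleval_tau u v s :
  mleval (if v == u then mlX R [set u]%SET else mlX R [set u; v]%SET) s = tau u v s.
Proof.
rewrite /tau; case: ifPn => vu; rewrite mleval_X ?sigmaK_set1 ?mulr1 //.
by rewrite /sigmaK big_setU1 ?inE 1?eq_sym //= big_set1.
Qed.

Lemma mlnorm_ge0 f : 0 <= mlnorm f.
Proof. exact: sumr_ge0. Qed.

(** Each pair [(A, B)] feeds a single coefficient of the product, so reduction can only merge or
    cancel terms. *)
Lemma mlnorm_mul f g : mlnorm (mlmul f g) <= mlnorm f * mlnorm g.
Proof.
rewrite /mlnorm big_distrlr /=.
have -> : \sum_A \sum_B `|f A| * `|g B| =
  \sum_K \sum_A \sum_(B | symdiff A B == K) `|f A| * `|g B| :> R.
  rewrite [RHS]exchange_big /=; apply: eq_bigr => A _.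
  under [RHS]eq_bigr do rewrite big_mkcond.
  rewrite [RHS]exchange_big /=; apply: eq_bigr => B _.
  rewrite (bigD1 (symdiff A B)) //= eqxx big1 ?addr0 // => K.
  by rewrite eq_sym => /negbTE ->.
apply: ler_sum => K _; rewrite ffunE.
apply: le_trans (ler_norm_sum _ _ _) _; apply: ler_sum => A _.
apply: le_trans (ler_norm_sum _ _ _) _; apply: ler_sum => B _.
by rewrite normrM.
Qed.

Lemma mlnorm_add f g : mlnorm (mladd f g) <= mlnorm f + mlnorm g.
Proof.
by rewrite /mlnorm -big_split; apply: ler_sum => K _; rewrite ffunE ler_normD.
Qed.

Lemma mlnorm_scale c f : mlnorm (mlscale c f) = `|c| * mlnorm f.
Proof.
by rewrite /mlnorm mulr_sumr; apply: eq_bigr => K _; rewrite ffunE normrM.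
Qed.

Lemma mlnorm_X K : mlnorm (mlX R K) = 1.
Proof.
rewrite /mlnorm (bigD1 K) //= big1 ?addr0 ?ffunE ?eqxx ?normr1 // => J /negbTE JK.
by rewrite ffunE JK normr0.
Qed.

Lemma mlnorm_zero : mlnorm (mlzero R p) = 0.
Proof. by rewrite /mlnorm big1 // => K _; rewrite ffunE normr0. Qed.

Lemma mlnorm_pow f k : mlnorm (mlpow f k) <= mlnorm f ^+ k.
Proof.
elim: k => [|k IH]; first by rewrite mlnorm_X.
rewrite /mlpow iterS exprS; apply: le_trans (mlnorm_mul _ _) _.
by apply: ler_wpM2l => //; exact: mlnorm_ge0.
Qed.

Lemma mlnorm_foldr {I : Type} (F : I -> mlpoly R p) f0 r :
  mlnorm (foldr (@mladd R p) f0 (map F r)) <= \sum_(i <- r) mlnorm (F i) + mlnorm f0.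
Proof.
elim: r => [|a r IH] /=; first by rewrite big_nil add0r.
apply: le_trans (mlnorm_add _ _) _.
by rewrite big_cons -addrA lerD2l.
Qed.

Lemma mlnorm_Epoly u (x : {ffun 'I_p -> R}) : mlnorm (Epoly u x) <= l1norm x.
Proof.
rewrite /Epoly; apply: le_trans (mlnorm_mul _ _) _; rewrite mlnorm_X mul1r.
apply: le_trans (mlnorm_foldr _ _ _) _.
rewrite mlnorm_scale mlnorm_X mulr1 big_filter big_enum_cond /= /l1norm.
rewrite [leRHS](bigD1 u) //= addrC lerD2r; apply: ler_sum => v _.
by rewrite mlnorm_scale mlnorm_X mulr1.
Qed.

Lemma mlnorm_Pd d f : mlnorm (Pd d f) <= \sum_(k < d.+1) mlnorm f ^+ k / (k`!)%:R.
Proof.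
rewrite /Pd; apply: le_trans (mlnorm_foldr _ _ _) _; rewrite mlnorm_zero addr0.
rewrite -[iota 0 d.+1]/(index_iota 0 d.+1) big_mkord.
apply: ler_sum => k _; rewrite mlnorm_scale normrM normrX normrN normr1 expr1n mul1r.
rewrite ger0_norm ?invr_ge0 // mulrC.
by apply: ler_wpM2r; [rewrite invr_ge0 | exact: mlnorm_pow].
Qed.

(* Parity in [sigma_u] is tracked separately: it is what keeps the moments
   needed for odd [d] at order [d + 1]. *)
Definition mldeg u (b : bool) (k : nat) f : Prop :=
  forall K, f K != 0 -> (u \in K) = b /\ (#|K :\ u| <= k)%N.

(** Membership of [u] adds modulo 2 under symmetric difference, and reduction never introduces a
    variable absent from both factors. *)
Lemma mldeg_mul u b1 b2 k1 k2 f g :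
  mldeg u b1 k1 f -> mldeg u b2 k2 g -> mldeg u (b1 (+) b2) (k1 + k2) (mlmul f g).
Proof.
move=> df dg K; rewrite ffunE => nz.
have [A [B [<- fA gB]]] : exists A B, [/\ symdiff A B = K, f A != 0 & g B != 0].
  apply: contrapT => H; move: nz; rewrite big1 ?eqxx // => A _; rewrite big1 // => B /eqP AB.
  have [->|fA] := eqVneq (f A) 0; first by rewrite mul0r.
  have [->|gB] := eqVneq (g B) 0; first by rewrite mulr0.
  by case: H; exists A, B.
have [<- cA] := df _ fA; have [<- cB] := dg _ gB; split.
  by rewrite /symdiff !inE; case: (u \in A); case: (u \in B).
apply: leq_trans (leq_add cA cB).
apply: leq_trans (leq_card_setU _ _); apply: subset_leq_card.
apply/fintype.subsetP => i; rewrite /symdiff !inE.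
by case: (i == u) => //=; case: (i \in A); case: (i \in B).
Qed.

Lemma mldeg_add u b k f g : mldeg u b k f -> mldeg u b k g -> mldeg u b k (mladd f g).
Proof.
move=> df dg K; rewrite ffunE.
have [fK|/df //] := eqVneq (f K) 0; have [gK|/dg //] := eqVneq (g K) 0.
by rewrite fK gK addr0 eqxx.
Qed.

Lemma mldeg_scale u b k c f : mldeg u b k f -> mldeg u b k (mlscale c f).
Proof.
by move=> df K; rewrite ffunE mulf_eq0 negb_or => /andP[_ /df].
Qed.

Lemma mldeg_X u K : mldeg u (u \in K) #|K :\ u|%SET (mlX R K).
Proof. by move=> J; rewrite ffunE; case: (J =P K) => [->|_]; rewrite ?eqxx. Qed.

Lemma mldeg_leq u b k l f : (k <= l)%N -> mldeg u b k f -> mldeg u b l f.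
Proof. by move=> kl df K /df[-> /leq_trans]; split; auto. Qed.

Lemma mldeg_Epoly u (x : 'I_p -> R) : mldeg u true 1 (Epoly u x).
Proof.
have X1 : mldeg u true 0 (mlX R [set u]%SET).
  have := @mldeg_X u [set u]%SET; rewrite set11.
  by rewrite [X in mldeg _ _ X _](_ : _ = 0%N) // finset.setDv cards0.
rewrite /Epoly; apply: (mldeg_mul X1 (b2 := false) (k2 := 1)).
rewrite (_ : [seq v <- enum 'I_p | v != u] = [seq v <- enum 'I_p | v \notin [set u]%SET]).
  elim: (enum 'I_p) => [|v r IH] /=.
    apply: mldeg_scale; have := @mldeg_X u finset.set0.
    by rewrite finset.in_set0 finset.set0D cards0; exact: mldeg_leq.
  case: ifPn => // vu /=; apply: mldeg_add => //; apply: mldeg_scale.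
  have := @mldeg_X u [set v]%SET; move: vu; rewrite !inE eq_sym => /negbTE ->.
  by apply: mldeg_leq; rewrite -(cards1 v) subset_leq_card // finset.subD1set.
by apply: eq_filter => v; rewrite !inE.
Qed.

Lemma mldeg_pow u b k f j : mldeg u b k f -> mldeg u (odd j && b) (j * k) (mlpow f j).
Proof.
move=> df; elim: j => [|j IH].
  have := @mldeg_X u finset.set0; rewrite finset.in_set0 finset.set0D cards0.
  exact: mldeg_leq.
rewrite /mlpow iterS mulSn (_ : odd j.+1 && b = b (+) (odd j && b)).
  exact: mldeg_mul.
by rewrite /=; case: (odd j); case: b {df IH}.
Qed.

Lemma mldeg_tau u v :
  mldeg u true 1 (if v == u then mlX R [set u]%SET else mlX R [set u; v]%SET).
Proof.
case: ifPn => vu.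
  have := @mldeg_X u [set u]%SET; rewrite set11 finset.setDv cards0; exact: mldeg_leq.
have := @mldeg_X u [set u; v]%SET; rewrite !inE eqxx; apply: mldeg_leq.
rewrite -(cards1 v) subset_leq_card //; apply/fintype.subsetP => i; rewrite !inE.
by case: (i == u).
Qed.

Lemma mlmul_foldr {I : Type} (F : I -> mlpoly R p) g r K :
  mlmul g (foldr (@mladd R p) (mlzero R p) (map F r)) K = \sum_(i <- r) mlmul g (F i) K.
Proof.
elim: r => [|a r IH] /=.
  rewrite big_nil ffunE big1 // => A _; rewrite big1 // => B _.
  by rewrite ffunE mulr0.
rewrite big_cons -IH !ffunE -big_split; apply: eq_bigr => A _.
by rewrite -big_split; apply: eq_bigr => B _; rewrite ffunE mulrDr.
Qed.

(** The term of degree [k] carries [k + 1] factors [sigma_u] and at most [k + 1] other variables.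
    For odd [k] those factors cancel; for even [k] one survives. So [k = d] gives at most
    [moment_order d] variables, and smaller [k] give at most [k + 2 <= d + 1]. *)
Lemma moment_order_bound u v d (x : 'I_p -> R) K :
  mlmul (if v == u then mlX R [set u]%SET else mlX R [set u; v]%SET)
    (Pd d (Epoly u x)) K != 0 -> (#|K| <= moment_order d)%N.
Proof.
rewrite mlmul_foldr; apply: contraNT; rewrite -ltnNge => Kd.
rewrite big_seq big1 // => k; rewrite mem_iota add0n => /andP[_ kd].
apply/eqP; apply: contraTT Kd => nz; rewrite -leqNgt.
have [uK cK] := mldeg_mul (@mldeg_tau u v)
  (mldeg_scale (mldeg_pow (j := k) (@mldeg_Epoly u x))) nz.
rewrite (cardsD1 u) uK andbT; apply: leq_trans (leq_add (leqnn _) cK) _.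
rewrite muln1 /moment_order.
move: kd; rewrite ltnS leq_eqVlt => /orP[/eqP ->|kd].
  by case: (odd d); rewrite /= ?subn0 ?subn1 //= add0n.
apply: leq_trans (_ : k.+2 <= _)%N; first by case: (odd k).
by rewrite leq_subRL; [case: (odd d); rewrite ?add0n ?add1n ?ltnS // ltnW | case: (odd d)].
Qed.

End Multilinear.

(** * Bounds on the exponential *)

Section ExponentialBounds.
Context {R : realType}.
Implicit Types (x y z gamma l m : R) (k n : nat).

Lemma ge0_is_derive_homo (f df : R -> R) x :
  (forall y, is_derive y (1 : R) f (df y)) -> (forall y, 0 < y -> 0 <= df y) ->
  0 <= x -> f 0 <= f x.
Proof.
move=> Hd Hpos x0.
have cf : {within `[0, x], continuous f}.
  by apply: derivable_within_continuous => y _; have [] := Hd y.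
apply: (ger0_derive1_le_cc _ _ cf) => //; rewrite ?in_itv /= ?lexx ?x0 //.
by move=> y; rewrite in_itv /= => /andP[y0 _]; rewrite derive1E derive_val Hpos.
Qed.

Lemma expR_partial_le x n : 0 <= x -> \sum_(k < n) x ^+ k / (k`!)%:R <= expR x.
Proof.
move=> x0; rewrite /expR -(big_mkord xpredT (fun k => x ^+ k / (k`!)%:R)).
apply: (nondecreasing_cvgn_le _ (is_cvg_series_exp_coeff x)).
apply: nondecreasing_series => k _ _; exact: exp_coeff_ge0.
Qed.

(* Consecutive terms have ratio at most [gamma / (n + 1) <= 1/3], so the tail is
   dominated by a geometric series. *)
Lemma exp_term_decay gamma n j : 0 <= gamma -> 3 * gamma <= n%:R ->
  gamma ^+ (n + j) / ((n + j)`!)%:R <= gamma ^+ n / (n`!)%:R * 3^-1 ^+ j.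
Proof.
move=> g0 gn; elim: j => [|j IH]; first by rewrite addn0 mulr1.
rewrite addnS factS natrM invfM !exprS.
have -> : gamma * gamma ^+ (n + j) * ((n + j).+1%:R^-1 / ((n + j)`!)%:R) =
  gamma ^+ (n + j) / ((n + j)`!)%:R * (gamma / (n + j).+1%:R) by ring.
rewrite [X in _ <= _ * X]mulrC [leRHS]mulrA; apply: ler_pM => //.
- by apply: divr_ge0; rewrite ?exprn_ge0.
- exact: divr_ge0.
rewrite ler_pdivrMr ?ltr0n // mulrC ler_pdivlMr // mulrC.
by apply: le_trans gn _; rewrite ler_nat leqW // leq_addr.
Qed.

(** Partial sums beyond index [n] are dominated by a geometric series of ratio 1/3, with sum 3/2;
    then pass to the limit. *)
Lemma expR_taylor_remainder gamma x n : `|x| <= gamma -> 3 * gamma <= n%:R ->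
  `|expR x - \sum_(k < n) x ^+ k / (k`!)%:R| <= 3 / 2 * (gamma ^+ n / (n`!)%:R).
Proof.
move=> xg gn; have g0 : 0 <= gamma by apply: le_trans xg.
set S := \sum_(k < n) _; set c := gamma ^+ n / _.
have c0 : 0 <= c by rewrite divr_ge0 // exprn_ge0.
have geo N : \sum_(j < N) (3^-1 : R) ^+ j <= 3 / 2.
  suff -> : \sum_(j < N) (3^-1 : R) ^+ j = 3 / 2 * (1 - 3^-1 ^+ N).
    have h : 0 <= (3^-1 : R) ^+ N by apply: exprn_ge0; rewrite invr_ge0.
    by lra.
  elim: N => [|N IH]; first by rewrite big_ord0 expr0 subrr mulr0.
  by rewrite big_ord_recr /= IH exprS; field.
have part N : `|series (exp_coeff x) (n + N)%N - S| <= 3 / 2 * c.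
  have -> : series (exp_coeff x) (n + N)%N - S
      = \sum_(j < N) x ^+ (n + j) / ((n + j)`!)%:R.
    by rewrite /series /= big_mkord big_split_ord /= addrAC subrr add0r.
  apply: le_trans (ler_norm_sum _ _ _) _.
  apply: (@le_trans _ _ (\sum_(j < N) c * 3^-1 ^+ j)).
    apply: ler_sum => j _; rewrite normrM normrX [X in _ * X]ger0_norm ?invr_ge0 //.
    apply: le_trans (exp_term_decay _ g0 gn); rewrite ler_wpM2r ?invr_ge0 //.
    by apply: lerXn2r => //; rewrite nnegrE.
  by rewrite -mulr_sumr mulrC ler_wpM2r.
have cvS : series (exp_coeff x) @ \oo --> expR x by exact: is_cvg_series_exp_coeff.
have cv : `|series (exp_coeff x) k - S| @[k --> \oo] --> `|expR x - S|.
  by apply: cvg_norm; apply: cvgB cvS _; exact: cvg_cst.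
apply: (cvgr_to_le cv); near=> k.
have nk : (n <= k)%N by near: k; exact: nbhs_infty_ge.
by rewrite -(subnKC nk); exact: part.
Unshelve. all: by end_near. Qed.

(** The left side is one term of the series of e^n; equivalently, n! >= (n / e)^n. *)
Lemma fact_ge_expn n : n%:R ^+ n / (n`!)%:R <= expR n%:R :> R.
Proof.
apply: le_trans (expR_partial_le n.+1 _) => //.
rewrite big_ord_recr /= lerDr; apply: sumr_ge0 => k _.
by rewrite divr_ge0 // exprn_ge0.
Qed.

(** The intermediate value theorem applies on [0, x] since 0 <= x <= x e^x, so [xget] never falls
    back on its default. *)
Lemma LambertW_spec x : 0 <= x -> -1 <= LambertW x /\ LambertW x * expR (LambertW x) = x.
Proof.
move=> x0; rewrite /LambertW.
have ct : {within `[0, x], continuous (fun w : R => w * expR w)}.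
  apply/continuous_subspaceT => w; apply: (@cvgM _ _ (nbhs w)).
    exact: cvg_id.
  exact: continuous_expR.
have [|w] := IVT (v := x) x0 ct.
  rewrite mul0r min_l ?max_r ?mulr_ge0 ?expR_ge0 // x0 /=.
  by rewrite ler_peMr // -expR0 ler_expR.
rewrite in_itv /= => /andP[w0 _] ww.
case: xgetP => [y -> //|/(_ w)]; case; split => //.
by apply: le_trans w0; rewrite lerN10.
Qed.

Lemma expR3half_le : expR (3 / 2) <= 6 :> R.
Proof.
have e : expR (1 / 4) <= 4 / 3 :> R.
  have := expR_ge1Dx (- (1 / 4) : R); rewrite expRN.
  rewrite -(ler_pM2r (expR_gt0 (1 / 4))) mulVf ?gt_eqF ?expR_gt0 // => h; lra.
have -> : expR (3 / 2) = expR (1 / 4) ^+ 6 :> R by rewrite -expRM_natr; congr expR; lra.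
apply: (@le_trans _ _ ((4 / 3) ^+ 6)); last by lra.
by apply: lerXn2r; rewrite // nnegrE ?expR_ge0 // divr_ge0.
Qed.

(* With [w = W(A)] and [e gamma A = 3 gamma + l], the hypothesis reads
   [gamma e^(1 + w) <= k], and [k! >= (k / e)^k] turns it into the bound. *)
Lemma taylor_degree gamma l k : 0 < gamma -> 0 <= l ->
  (3 * gamma + l) / LambertW (3 / expR 1 + (gamma * expR 1)^-1 * l) <= k%:R ->
  3 * gamma <= k%:R /\ gamma ^+ k / (k`!)%:R <= expR (- (3 * gamma + l)).
Proof.
move=> g0 l0; set A := 3 / expR 1 + _; set w := LambertW A => Hk.
have e0 : 0 < expR 1 :> R := expR_gt0 _.
have eA : expR 1 * A = 3 + l / gamma by rewrite /A; field; rewrite !gt_eqF.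
have A_ge : 3 <= expR 1 * A by rewrite eA lerDl divr_ge0 // ltW.
have A_gt0 : 0 < A by rewrite -(pmulr_rgt0 _ e0); apply: lt_le_trans A_ge.
have [_ wA] := LambertW_spec (ltW A_gt0); rewrite -/w in wA.
have w_gt0 : 0 < w by rewrite -(pmulr_lgt0 _ (expR_gt0 w)) wA.
(* If w < 1/2 then w e^(1 + w) < 6 / 2 = 3, against e A >= 3. This bound on [w] is what makes e^(1 +
   w) >= e^(3/2) >= 3. *)
have w_half : 1 / 2 <= w.
  rewrite leNgt; apply/negP => wlt; suff : expR 1 * A < 3 by rewrite ltNge A_ge.
  rewrite -wA mulrCA -expRD.
  have h1 : expR (1 + w) < 6.
    by apply: lt_le_trans expR3half_le; rewrite ltr_expR; lra.
  have h2 := expR_gt0 (1 + w); nra.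
have ge3 : 3 <= expR (1 + w).
  apply: (@le_trans _ _ (expR (3 / 2))); last by rewrite ler_expR; lra.
  apply: le_trans (expR_partial_le 3 _); last by lra.
  by rewrite !big_ord_recr big_ord0 /= !factS !fact0; lra.
have gk : gamma * expR (1 + w) <= k%:R.
  apply: le_trans Hk; rewrite ler_pdivlMr //.
  rewrite expRD -mulrA -[_ * expR w * w]mulrA [expR w * w]mulrC wA eA.
  by rewrite mulrDr [gamma * 3]mulrC mulrCA divff ?mulr1 ?gt_eqF.
have Hk' : 3 * gamma + l <= w * k%:R by rewrite [w * _]mulrC -ler_pdivrMr.
split; first by apply: le_trans gk; rewrite mulrC ler_pM2l.
have -> : gamma ^+ k = (gamma * expR (1 + w)) ^+ k * expR (- (k%:R * (1 + w))).
  by rewrite exprMn -expRM_natl -mulrA -expRD addrN expR0 mulr1.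
apply: (@le_trans _ _ (k%:R ^+ k / (k`!)%:R * expR (- (k%:R * (1 + w))))).
  rewrite mulrAC ler_wpM2r ?expR_ge0 // ler_wpM2r ?invr_ge0 //.
  by apply: lerXn2r; rewrite // nnegrE ?mulr_ge0 ?expR_ge0 ?ler0n // ltW.
apply: (@le_trans _ _ (expR k%:R * expR (- (k%:R * (1 + w))))).
  by rewrite ler_wpM2r ?expR_ge0 // fact_ge_expn.
by rewrite -expRD ler_expR; lra.
Qed.

(** For z >= 0, clearing denominators leaves (z - 2) e^z + z + 2 >= 0, whose left side vanishes at 0
    and is nondecreasing. For z < 0 the Taylor polynomial of order 2 already gives z^2 / 2. *)
Lemma sqr_div_le_expR z : z ^+ 2 / (2 + `|z|) <= expR (- z) - 1 + z.
Proof.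
have [z0|z0] := leP 0 z.
  have h : 0 <= (z - 2) * expR z + z + 2.
    have -> : 0 = (0 - 2) * expR 0 + 0 + 2 :> R by rewrite expR0; ring.
    apply: (@ge0_is_derive_homo (fun z => (z - 2) * expR z + z + 2)
      (fun z => (z - 1) * expR z + 1)) z0 => y.
      apply: is_derive_eq; rewrite /GRing.scale /=; ring.
    move=> _; rewrite -lerBlDr sub0r -[leRHS]opprK lerN2 -mulNr opprB.
    rewrite -ler_pdivlMr ?expR_gt0 // mul1r -expRN.
    by have := expR_ge1Dx (- y).
  rewrite ger0_norm // ler_pdivrMr ?ltr_wpDr // expRN.
  have e0 := expR_gt0 z; rewrite -(ler_pM2r e0).
  have -> : ((expR z)^-1 - 1 + z) * (2 + z) * expR z =
    (2 + z) + (z - 1) * (2 + z) * expR z by field; rewrite gt_eqF.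
  by rewrite -subr_ge0; apply: le_trans h _; rewrite le_eqVlt; apply/orP; left; apply/eqP; ring.
rewrite ltr0_norm //; set y := - z; have y0 : 0 < y by rewrite oppr_gt0.
have := @expR_partial_le y 3 (ltW y0).
rewrite !big_ord_recr big_ord0 /= add0r expr0 expr1 !fact0 divr1 factS fact0 muln1 divr1.
rewrite (_ : 2`! = 2)%N // => e.
have -> : z = - y by rewrite opprK.
rewrite sqrrN; apply: (@le_trans _ _ (y ^+ 2 / 2)); last by lra.
apply: ler_wpM2l; first exact: sqr_ge0.
by rewrite lef_pV2 ?posrE ?addr_gt0 // lerDl ltW.
Qed.

(** The left side is the moment generating function of a spin of mean [m]. Its logarithm has
    derivative [N / D], the tilted mean, whose own derivative 1 - (N / D)^2 is at most 1;
    integrating twice gives l m + l^2 / 2. *)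
Lemma hoeffding_spin m l : -1 <= m <= 1 -> 0 <= l ->
  (1 + m) / 2 * expR l + (1 - m) / 2 * expR (- l) <= expR (l * m + l ^+ 2 / 2).
Proof.
move=> /andP[m1 m2] l0; set a := (1 + m) / 2; set b := (1 - m) / 2.
have a0 : 0 <= a by rewrite divr_ge0 // -lerBlDl sub0r.
have b0 : 0 <= b by rewrite divr_ge0 // subr_ge0.
have ab : a + b = 1 by rewrite /a /b; field.
pose D x : R := a * expR x + b * expR (- x).
pose N x : R := a * expR x - b * expR (- x).
(* The extreme mean [m = -1] makes [a] vanish, and positivity must then come from [b]. *)
have D_gt0 x : 0 < D x.
  have [a1|a1] := eqVneq a 0.
    by rewrite /D a1 mul0r add0r mulr_gt0 ?expR_gt0 //; move: ab; rewrite a1 add0r => ->.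
  apply: ltr_pwDl; first by rewrite mulr_gt0 ?expR_gt0 // lt0r a1.
  by rewrite mulr_ge0 ?expR_ge0.
have dD x : is_derive x (1 : R) D (N x).
  by apply: is_derive_eq; rewrite /GRing.scale /= /N; ring.
have dN x : is_derive x (1 : R) N (D x).
  by apply: is_derive_eq; rewrite /GRing.scale /= /D; ring.
have G0 x : 0 <= x -> N x <= (m + x) * D x.
  move=> x0.
  have : 0 <= m + x - N x / D x.
    have -> : 0 = m + 0 - N 0 / D 0.
      by rewrite /N /D oppr0 expR0 !mulr1 ab /a /b; field.
    apply: (@ge0_is_derive_homo (fun x => m + x - N x / D x)
      (fun x => N x ^+ 2 / D x ^+ 2)) x0 => y; last first.
      by move=> _; rewrite divr_ge0 ?sqr_ge0.
    have Dn : D y != 0 by rewrite gt_eqF.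
    have dV := is_deriveV Dn (dD y).
    by apply: is_derive_eq; rewrite /GRing.scale /=; field.
  by rewrite subr_ge0 ler_pdivrMr.
(* The sign is reversed because [ge0_is_derive_homo] treats nondecreasing functions. *)
pose F x := - (D x * expR (- (x * m + x ^+ 2 / 2))).
have : F 0 <= F l.
  apply: (@ge0_is_derive_homo F
     (fun x => ((m + x) * D x - N x) * expR (- (x * m + x ^+ 2 / 2)))) l0 => y.
    by apply: is_derive_eq; rewrite /GRing.scale /=; field.
  by move=> y0; rewrite mulr_ge0 ?expR_ge0 // subr_ge0 G0 // ltW.
rewrite /F lerN2 mul0r expr0n mul0r addr0 oppr0 expR0 mulr1 expRN.
by rewrite ler_pdivrMr ?expR_gt0 // /D oppr0 expR0 !mulr1 ab mul1r.
Qed.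

End ExponentialBounds.

(** * The interaction screening objective *)

Section Energy.
Context {R : realType} {p : nat}.
Implicit Types (x y : 'I_p -> R) (s : config p) (u v : 'I_p).

(** Pairing [s] with [flip v s] plays the role of conditioning on all spins other than [v]. *)
Definition flip v s : config p := [ffun i => if i == v then ~~ s i else s i].

Lemma flipK v : involutive (flip v).
Proof. by move=> s; apply/ffunP => i; rewrite !ffunE; case: (i == v); rewrite ?negbK. Qed.

Lemma sum_flip v (F : config p -> R) : \sum_s F (flip v s) = \sum_s F s.
Proof.
rewrite [RHS](reindex_inj (h := flip v)) //; exact: can_inj (@flipK v).
Qed.

Lemma spin_flip v s i : spin R (flip v s) i = (-1) ^+ (i == v) * spin R s i.
Proof.
by rewrite /spin ffunE; case: eqP => _; case: (s i); rewrite /= ?mul1r // mulN1r ?opprK.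
Qed.

Lemma tau_flip u v s : tau u v (flip u s) = - tau u v s :> R.
Proof.
rewrite /tau !spin_flip eqxx expr1 mulN1r mulNr; case: eqP => // _.
by rewrite mul1r.
Qed.

Lemma energy_flip u x s : energy u x (flip u s) = - energy u x s.
Proof.
by rewrite /energy -sumrN; apply: eq_bigr => v _; rewrite tau_flip mulrN.
Qed.

Lemma energyB u x y s : energy u x s - energy u y s = energy u (fun v => x v - y v) s.
Proof. by rewrite /energy -sumrB; apply: eq_bigr => v _; rewrite mulrBl. Qed.

Lemma energy_flip_neq u v x s : v != u ->
  energy u x s - energy u x (flip v s) = 2 * x v * tau u v s.
Proof.
move=> vu; rewrite /energy -sumrB (bigD1 v) //= big1 ?addr0 => [|i iv].
  rewrite /tau (negbTE vu) !spin_flip eqxx eq_sym (negbTE vu) expr0 expr1 mul1r; ring.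
by rewrite /tau !spin_flip (negbTE iv) [u == v]eq_sym (negbTE vu) expr0 !mul1r subrr.
Qed.

Lemma normr_energy u (x : {ffun 'I_p -> R}) s : `|energy u x s| <= l1norm x.
Proof.
apply: le_trans (ler_norm_sum _ _ _) _; apply: ler_sum => v _.
by rewrite normrM normr_tau mulr1.
Qed.

End Energy.

(** The masses [a] and [b] are within a factor [c] of each other, so 4 a b >= c (a + b)^2. After
    scaling by a + b, the second moment exceeds the variance term by the square 4 (a x + b y)^2. *)
Lemma two_point_variance {R : realFieldType} (a b c x y : R) :
  0 < a -> 0 < b -> 0 <= c -> c * a <= b -> c * b <= a ->
  c * (a + b) * (x - y) ^+ 2 <= 4 * (a * x ^+ 2 + b * y ^+ 2).
Proof.
move=> a0 b0 c0 cab cba.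
have ab0 : 0 < a + b by exact: addr_gt0.
rewrite -(ler_pM2r ab0).
apply: (@le_trans _ _ (4 * (a * b) * (x - y) ^+ 2)).
  have -> : c * (a + b) * (x - y) ^+ 2 * (a + b) = c * (a + b) ^+ 2 * (x - y) ^+ 2 by ring.
  rewrite ler_wpM2r ?sqr_ge0 //.
  have [leab|/ltW leba] := leP a b.
    have : (a + b) ^+ 2 <= (2 * b) ^+ 2 by rewrite lerXn2r ?nnegrE; lra.
    nra.
  have : (a + b) ^+ 2 <= (2 * a) ^+ 2 by rewrite lerXn2r ?nnegrE; lra.
  nra.
rewrite -subr_ge0; have -> : 4 * (a * x ^+ 2 + b * y ^+ 2) * (a + b)
  - 4 * (a * b) * (x - y) ^+ 2 = 4 * (a * x + b * y) ^+ 2 by ring.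
by rewrite mulr_ge0 ?sqr_ge0.
Qed.

(** * The Ising measure and the curvature of the screening objective *)

Section IsingModel.
Context {R : realType} {p : nat}.
Variables (th : 'I_p -> 'I_p -> R) (h : 'I_p -> R).
Hypothesis hsym : forall u v, th u v = th v u.
Implicit Types (x y : {ffun 'I_p -> R}) (s : config p) (u v : 'I_p).

Let mu := ising_mu th h.

Definition local_param u : {ffun 'I_p -> R} := [ffun v => if v == u then h u else th u v].

(** Symmetry of [th] enters here, since the Hamiltonian lists each pair once, with the smaller index
    first. *)
Lemma ising_H_flip u s :
  ising_H th h (flip u s) = ising_H th h s - 2 * energy u (local_param u) s.
Proof.
have -> : 2 * energy u (local_param u) s =
    2 * (h u * spin R s u) + \sum_(v | v != u) 2 * th u v * spin R s u * spin R s v.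
  rewrite /energy (bigD1 u) //= mulrDr /tau eqxx mulr1 ffunE eqxx; congr (_ + _).
  rewrite mulr_sumr; apply: eq_bigr => v vu; rewrite ffunE (negbTE vu); ring.
have Hf : \sum_i h i * spin R (flip u s) i
    = \sum_i h i * spin R s i - 2 * (h u * spin R s u).
  rewrite (bigD1 u) //= [in RHS](bigD1 u) //= spin_flip eqxx expr1.
  have -> : \sum_(i | i != u) h i * spin R (flip u s) i = \sum_(i | i != u) h i * spin R s i.
    by apply: eq_bigr => i /negbTE iu; rewrite spin_flip iu mul1r.
  ring.
have Hq : \sum_(i < p) \sum_(j < p | (i < j)%N) th i j * spin R (flip u s) i * spin R (flip u s) j
    = \sum_(i < p) \sum_(j < p | (i < j)%N) th i j * spin R s i * spin R s j
      - \sum_(v | v != u) 2 * th u v * spin R s u * spin R s v.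
  pose F (i j : 'I_p) := 2 * th i j * spin R s i * spin R s j.
  have E : \sum_(i < p) \sum_(j < p | (i < j)%N) th i j * spin R (flip u s) i * spin R (flip u s) j
    = \sum_(i < p) \sum_(j < p | (i < j)%N) th i j * spin R s i * spin R s j
      - (\sum_(i < p) \sum_(j < p | (i < j)%N) (i == u)%:R * F i j +
         \sum_(i < p) \sum_(j < p | (i < j)%N) (j == u)%:R * F i j).
    (* A pair changes sign exactly when one of its ends is [u]; both cannot be, because [i < j]. *)
    rewrite -big_split /= -sumrB; apply: eq_bigr => i _.
    rewrite -big_split /= -sumrB; apply: eq_bigr => j ij; rewrite !spin_flip /F.
    have [iu|iu] := eqVneq i u; have [ju|ju] := eqVneq j u;
      rewrite /= ?expr0 ?expr1; try ring.
    by move: ij; rewrite iu ju ltnn.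
  rewrite E; congr (_ - _).
  have -> : \sum_(i < p) \sum_(j < p | (i < j)%N) (i == u)%:R * F i j = \sum_(j < p | (u < j)%N) F u j.
    rewrite (bigD1 u) //= [X in _ + X]big1 ?addr0 => [|i /negbTE iu].
      by apply: eq_bigr => j _; rewrite eqxx mul1r.
    by rewrite big1 // => j _; rewrite iu mul0r.
  have -> : \sum_(i < p) \sum_(j < p | (i < j)%N) (j == u)%:R * F i j = \sum_(i < p | (i < u)%N) F u i.
    rewrite (exchange_big_dep xpredT) //= (bigD1 u) //= [X in _ + X]big1 ?addr0 => [|j /negbTE ju].
      by apply: eq_bigr => i _; rewrite eqxx mul1r /F hsym; ring.
    by rewrite big1 // => i _; rewrite ju mul0r.
  rewrite [RHS](bigID (fun v : 'I_p => (u < v)%N)) /=; congr (_ + _).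
    by apply: eq_bigl => j; rewrite andb_idl // => uj; rewrite -(inj_eq val_inj) gtn_eqF.
  by apply: eq_bigl => j; rewrite -leqNgt ltn_neqAle.
by rewrite /ising_H Hf Hq; ring.
Qed.

Lemma ising_Z_gt0 : 0 < \sum_(s : config p) expR (ising_H th h s).
Proof.
apply: (@lt_le_trans _ _ (expR (ising_H th h [ffun=> true]))); first exact: expR_gt0.
rewrite (bigD1 [ffun=> true]) //= lerDl; apply: sumr_ge0 => s _; exact: expR_ge0.
Qed.

Lemma ising_mu_gt0 s : 0 < mu s.
Proof. by rewrite /mu /ising_mu divr_gt0 ?expR_gt0 ?ising_Z_gt0. Qed.

Lemma ising_mu_sum : \sum_s mu s = 1.
Proof. by rewrite /mu /ising_mu -mulr_suml divff // gt_eqF ?ising_Z_gt0. Qed.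

Lemma ising_mu_flip u s : mu (flip u s) = mu s * expR (- (2 * energy u (local_param u) s)).
Proof. by rewrite /mu /ising_mu ising_H_flip expRD mulrAC. Qed.

Definition screening u (x : 'I_p -> R) : R := \sum_s mu s * expR (- energy u x s).

(** The gradient is introduced by its formula and never as a limit; [screening_subgrad] is what
    certifies it. *)
Definition screening_grad u (x : 'I_p -> R) v : R :=
  - \sum_s mu s * (tau u v s * expR (- energy u x s)).

(* [mu s * exp (- E_u s)] does not depend on [s u], while [tau] is odd in it. *)
Lemma screening_grad_local_param u v : screening_grad u (local_param u) v = 0.
Proof.
apply/eqP; rewrite oppr_eq0; set S := \sum_s _.
suff : S = - S by move/eqP; rewrite -addr_eq0 -mulr2n mulrn_eq0.
rewrite {1}/S -(sum_flip u) -sumrN; apply: eq_bigr => s _.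
rewrite ising_mu_flip tau_flip energy_flip opprK.
have -> : expR (- energy u (local_param u) s) =
    expR (- (2 * energy u (local_param u) s)) * expR (energy u (local_param u) s).
  by rewrite -expRD; congr expR; ring.
ring.
Qed.

Lemma screening_grad_sum u (x : 'I_p -> R) (d : 'I_p -> R) :
  \sum_v screening_grad u x v * d v =
  - \sum_s mu s * expR (- energy u x s) * energy u d s.
Proof.
rewrite -sumrN /screening_grad.
under eq_bigr do rewrite -sumrN mulr_suml.
rewrite exchange_big /=; apply: eq_bigr => s _.
have -> : energy u d s = \sum_v d v * tau u v s by [].
rewrite mulr_sumr -[RHS]sumrN; apply: eq_bigr => v _; ring.
Qed.

(** Average e^(-b) >= e^(-a) (1 - (b - a)) over [mu], with a and b the energies at [x] and [y]. *)
Lemma screening_subgrad u (x y : 'I_p -> R) :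
  screening u x + \sum_v screening_grad u x v * (y v - x v) <= screening u y.
Proof.
rewrite screening_grad_sum /screening -sumrB; apply: ler_sum => s _.
rewrite -mulrA -mulrBr ler_wpM2l ?(ltW (ising_mu_gt0 _)) // -energyB.
have -> : expR (- energy u y s) =
    expR (- energy u x s) * expR (- (energy u y s - energy u x s)).
  by rewrite -expRD; congr expR; ring.
have := ler_wpM2l (expR_ge0 (- energy u x s)) (expR_ge1Dx (- (energy u y s - energy u x s))).
by rewrite mulrDr mulr1 mulrN.
Qed.

Variable gamma : R.
Hypothesis hwidth : l1_width_le th h gamma.

Lemma l1norm_local_param u : l1norm (local_param u) <= gamma.
Proof.
apply: le_trans (hwidth u); rewrite /l1norm (bigD1 u) //= ffunE eqxx addrC lerD2r.
by apply: ler_sum => v /negbTE vu; rewrite ffunE vu.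
Qed.

Lemma gamma_ge0 u : 0 <= gamma.
Proof. by apply: le_trans (l1norm_local_param u); exact: sumr_ge0. Qed.

(** Flipping [v] changes the weight by a factor between e^(-2 gamma) and e^(2 gamma), and the energy
    by 2 x_v in absolute value, so the two-point bound applies to each pair. *)
Lemma energy_variance u v (x : 'I_p -> R) : v != u ->
  expR (- (2 * gamma)) * x v ^+ 2 <= \sum_s mu s * energy u x s ^+ 2.
Proof.
(* The factor 2 symmetrises the sum: [s] and [flip v s] are both enumerated. *)
move=> vu; rewrite -(ler_pM2l (ltr0n R 2)).
have -> : 2 * (\sum_s mu s * energy u x s ^+ 2) = \sum_s (mu s * energy u x s ^+ 2
    + mu (flip v s) * energy u x (flip v s) ^+ 2).
  rewrite big_split /= (sum_flip v (fun s => mu s * energy u x s ^+ 2)); ring.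
have -> : 2 * (expR (- (2 * gamma)) * x v ^+ 2) =
    \sum_s (expR (- (2 * gamma)) * (mu s + mu (flip v s)) * x v ^+ 2).
  rewrite -mulr_suml -mulr_sumr big_split /= (sum_flip v mu) ising_mu_sum; ring.
apply: ler_sum => s _.
have gE : `|energy v (local_param v) s| <= gamma.
  by apply: le_trans (l1norm_local_param v); exact: normr_energy.
move: gE; rewrite ler_norml => /andP[gE1 gE2].
have c1 : expR (- (2 * gamma)) * mu s <= mu (flip v s).
  by rewrite ising_mu_flip [leLHS]mulrC ler_wpM2l ?(ltW (ising_mu_gt0 _)) // ler_expR; lra.
have c2 : expR (- (2 * gamma)) * mu (flip v s) <= mu s.
  rewrite ising_mu_flip mulrCA -expRD -[leRHS]mulr1 ler_wpM2l ?(ltW (ising_mu_gt0 _)) //.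
  by rewrite -[leRHS]expR0 ler_expR; lra.
have := two_point_variance (energy u x s) (energy u x (flip v s))
  (ising_mu_gt0 s) (ising_mu_gt0 (flip v s)) (expR_ge0 _) c1 c2.
have t2 : tau u v s ^+ 2 = 1 :> R by rewrite -[LHS]real_normK ?num_real // normr_tau expr1n.
have -> : (energy u x s - energy u x (flip v s)) ^+ 2 = 4 * x v ^+ 2.
  transitivity (4 * x v ^+ 2 * tau u v s ^+ 2); last by rewrite t2 mulr1.
  by rewrite energy_flip_neq //; ring.
move=> H; rewrite -(ler_pM2l (ltr0n R 4)); apply: le_trans H.
by rewrite le_eqVlt; apply/orP; left; apply/eqP; ring.
Qed.

(** At the true parameters the weight e^(-E) is at least e^(-gamma) and the linear term averages to
    0. The rest is at least z^2 / (2 + 2 gamma), as the energy difference z is at most 2 gamma in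
    absolute value, and [energy_variance] supplies e^(-2 gamma). *)
Lemma screening_strong_convexity u v x : v != u -> l1norm x <= gamma ->
  (x v - th u v) ^+ 2 * (expR (- (3 * gamma)) / (2 * (1 + gamma)))
  <= screening u x - screening u (local_param u).
Proof.
move=> vu xg; have g0 := gamma_ge0 u.
set t := local_param u; pose d w := x w - t w.
have dv : x v - th u v = d v by rewrite /d /t ffunE (negbTE vu).
have G : \sum_s mu s * expR (- energy u t s) * energy u d s = 0.
  apply/eqP; rewrite -oppr_eq0 -screening_grad_sum big1 // => w _.
  by rewrite screening_grad_local_param mul0r.
have -> : screening u x - screening u t = \sum_s (mu s * (expR (- energy u t s) *
    (expR (- energy u d s) - 1 + energy u d s))).
  rewrite /screening -sumrB -[LHS]addr0 -[X in _ + X = _]G -big_split; apply: eq_bigr => s _ /=.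
  have -> : energy u x s = energy u t s + energy u d s by rewrite -energyB; ring.
  by rewrite opprD expRD; ring.
have sE : \sum_s mu s * energy u d s ^+ 2 * (expR (- gamma) / (2 + 2 * gamma)) <=
   \sum_s (mu s * (expR (- energy u t s) * (expR (- energy u d s) - 1 + energy u d s))).
  apply: ler_sum => s _; rewrite -mulrA ler_wpM2l ?(ltW (ising_mu_gt0 _)) //.
  rewrite mulrCA; apply: ler_pM; rewrite ?expR_ge0 //.
  - by rewrite divr_ge0 ?sqr_ge0 // addr_ge0 // mulr_ge0.
  - rewrite ler_expR lerN2; apply: le_trans (ler_norm _) _.
    exact: le_trans (normr_energy _ _ _) (l1norm_local_param u).
  apply: le_trans (sqr_div_le_expR _).
  rewrite ler_wpM2l ?sqr_ge0 // lef_pV2 ?posrE ?ltr_wpDr ?mulr_ge0 // lerD2l.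
  rewrite -energyB; apply: le_trans (ler_normB _ _) _; rewrite mulr_natl mulr2n.
  apply: lerD; first exact: le_trans (normr_energy _ _ _) xg.
  exact: le_trans (normr_energy _ _ _) (l1norm_local_param u).
apply: le_trans sE; rewrite -mulr_suml dv.
have c0 : 0 <= expR (- gamma) / (2 + 2 * gamma).
  by rewrite divr_ge0 ?expR_ge0 // addr_ge0 // mulr_ge0.
apply: le_trans (ler_wpM2r c0 (energy_variance d vu)).
have -> : - (3 * gamma) = - (2 * gamma) + - gamma by ring.
rewrite expRD le_eqVlt; apply/orP; left; apply/eqP.
have -> : 2 * (1 + gamma) = 2 + 2 * gamma by ring.
ring.
Qed.

End IsingModel.

(** * Projected gradient descent *)

Section ProjectedGradient.
Context {R : realType} {p : nat}.
Implicit Types (x y z : {ffun 'I_p -> R}).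

Lemma continuous_sum_coord (F : 'I_p -> 'rV[R]_p -> R) :
  (forall i, continuous (F i)) -> continuous (fun v => \sum_i F i v).
Proof.
by move=> Fc; apply: continuous_big => //; exact: add_continuous.
Qed.

(** A minimiser exists because the l1 ball is compact and the squared distance continuous, so the
    default of [xget] is never returned. Row vectors carry the topology. *)
Lemma proj_l1_spec (gamma : R) x : 0 <= gamma ->
  l1norm (proj_l1 gamma x) <= gamma /\
  forall z, l1norm z <= gamma -> sqdist x (proj_l1 gamma x) <= sqdist x z.
Proof.
move=> g0; pose A := [set v : 'rV[R]_p | \sum_i `|v ord0 i| <= gamma].
have cc i : continuous (fun v : 'rV[R]_p => v ord0 i) by exact: coord_continuous.
have A0 : A !=set0 by exists 0; rewrite /A /= big1 // => i _; rewrite mxE normr0.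
have clA : closed A.
  apply: (@closed_comp _ _ (fun v : 'rV[R]_p => \sum_i `|v ord0 i|) [set r | r <= gamma]).
    move=> v _; apply: continuous_sum_coord => i w.
    exact: (continuous_comp (cc i w) (@norm_continuous _ _ _)).
  exact: closed_le.
have cA : compact A.
  apply: (subclosed_compact clA (rV_compact (fun i : 'I_p => @segment_compact R (- gamma) gamma))).
  move=> v Av i /=; rewrite in_itv /= -ler_norml; apply: le_trans Av.
  by rewrite (bigD1 i) //= lerDl sumr_ge0.
have cf : {within A, continuous (fun v : 'rV[R]_p => \sum_i (x i - v ord0 i) ^+ 2)}.
  apply: continuous_subspaceT; apply: continuous_sum_coord => i w.
  apply: (@continuous_comp _ _ _ (fun v : 'rV[R]_p => x i - v ord0 i) (fun r : R => r ^+ 2)).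
    exact: cvgB (cvg_cst _) (cc i w).
  exact: exprn_continuous.
have [c cinA cmin] := EVT_min_rV A0 cA cf.
rewrite inE in cinA.
have Hc : [set y | l1norm y <= gamma /\ forall z, l1norm z <= gamma -> sqdist x y <= sqdist x z]
    [ffun i => c ord0 i].
  split; first by rewrite /l1norm; under eq_bigr do rewrite ffunE.
  move=> z zg; have := cmin (\row_i z i); rewrite inE /A /=.
  under eq_bigr do rewrite mxE; move=> /(_ zg).
  under [leRHS]eq_bigr do rewrite mxE; rewrite /sqdist.
  by under [X in _ -> X <= _]eq_bigr do rewrite ffunE.
by rewrite /proj_l1; case: xgetP => [y _ //|/(_ _ Hc)].
Qed.

(** With y the projection, the variational inequality <x - y, z - y> <= 0 gives |x - z|^2 >= |x -
    y|^2 + |y - z|^2. It is found by moving y slightly towards [z]. *)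
Lemma proj_l1_nonexpansive (gamma : R) x z : 0 <= gamma -> l1norm z <= gamma ->
  sqdist (proj_l1 gamma x) z <= sqdist x z.
Proof.
move=> g0 zg; have [yg ymin] := proj_l1_spec x g0.
set y := proj_l1 gamma x in yg ymin *.
pose c := \sum_i (x i - y i) * (z i - y i); pose D := sqdist y z.
have D0 : 0 <= D by apply: sumr_ge0 => i _; exact: sqr_ge0.
have segment t : 0 <= t <= 1 -> 2 * t * c <= t ^+ 2 * D.
  move=> /andP[t0 t1]; pose yt := [ffun i => y i + t * (z i - y i)].
  have /ymin : l1norm yt <= gamma.
    apply: (@le_trans _ _ ((1 - t) * l1norm y + t * l1norm z)); last by nra.
    rewrite /l1norm !mulr_sumr -big_split; apply: ler_sum => i _; rewrite ffunE.
    have -> : y i + t * (z i - y i) = (1 - t) * y i + t * z i by ring.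
    by apply: le_trans (ler_normD _ _) _; rewrite !normrM (ger0_norm t0) (@ger0_norm _ (1 - t)) ?subr_ge0.
  have -> : sqdist x yt = sqdist x y - 2 * t * c + t ^+ 2 * D.
    rewrite /sqdist /c /D /sqdist !mulr_sumr -sumrB -big_split; apply: eq_bigr => i _ /=.
    by rewrite ffunE; ring.
  lra.
have c0 : c <= 0.
  rewrite leNgt; apply/negP => cp.
  have cD : 0 < c + D by exact: ltr_wpDr.
  (* This value lies in [0, 1] even when [D = 0], and makes 2 t c exceed t^2 D, contradicting
     minimality. *)
  have := segment (c / (c + D)).
  rewrite divr_ge0 ?(ltW cp) ?(ltW cD) // ler_pdivrMr // mul1r lerDl D0 => /(_ isT).
  have -> : 2 * (c / (c + D)) * c = 2 * c ^+ 2 * (c + D) / (c + D) ^+ 2.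
    by field; rewrite gt_eqF.
  have -> : (c / (c + D)) ^+ 2 * D = c ^+ 2 * D / (c + D) ^+ 2.
    by field; rewrite gt_eqF.
  rewrite ler_pM2r ?invr_gt0 ?exprn_gt0 // => H.
  have : 0 < c ^+ 2 * (2 * c + D).
    by rewrite mulr_gt0 ?exprn_gt0 // ltr_wpDr // mulr_gt0.
  lra.
have -> : sqdist x z = sqdist x y - 2 * c + D.
  rewrite /sqdist /c /D /sqdist !mulr_sumr -sumrB -big_split; apply: eq_bigr => i _ /=.
  ring.
have : 0 <= sqdist x y by apply: sumr_ge0 => i _; exact: sqr_ge0.
by rewrite -/D; lra.
Qed.

(** Convertible to [alg1_iterate] when [g] is [approx_grad], but independent of how the gradient is
    obtained. *)
Definition pgd (gamma eta : R) (g : {ffun 'I_p -> R} -> {ffun 'I_p -> R}) (k : nat) :=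
  iter k (fun x : {ffun 'I_p -> R} => proj_l1 gamma [ffun i => x i - eta * g x i])
    [ffun=> 0].

Lemma pgd_l1norm (gamma eta : R) g k : 0 <= gamma -> l1norm (pgd gamma eta g k) <= gamma.
Proof.
move=> g0; case: k => [|k]; last exact: (proj1 (proj_l1_spec _ g0)).
by rewrite /l1norm big1 // => i _; rewrite ffunE normr0.
Qed.

(** The squared distance to [z] telescopes: each step lowers it by 2 eta <g, x - z>, up to eta^2 p
    G^2. It starts at no more than gamma^2 because |z|_2 <= |z|_1. *)
Lemma pgd_regret (gamma eta G : R) (g : {ffun 'I_p -> R} -> {ffun 'I_p -> R}) z T : 0 <= gamma -> 0 < eta -> l1norm z <= gamma ->
  (forall x i, l1norm x <= gamma -> `|g x i| <= G) ->
  \sum_(k < T) \sum_i g (pgd gamma eta g k) i * (pgd gamma eta g k i - z i)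
  <= gamma ^+ 2 / (2 * eta) + eta / 2 * (T%:R * (p%:R * G ^+ 2)).
Proof.
move=> g0 e0 zg Hg.
have start : sqdist (pgd gamma eta g 0) z <= gamma ^+ 2.
  apply: (@le_trans _ _ (l1norm z ^+ 2)); last first.
    by rewrite lerXn2r ?nnegrE ?sumr_ge0.
  rewrite /sqdist expr2 {1}/l1norm mulr_suml; apply: ler_sum => i _.
  rewrite ffunE sub0r sqrrN -real_normK ?num_real // expr2 ler_wpM2l //.
  by rewrite /l1norm (bigD1 i) //= lerDl sumr_ge0.
(* The final distance stays on the left so that the induction on [T] closes; it is dropped
   afterwards. *)
suff H : 2 * eta * \sum_(k < T) \sum_i g (pgd gamma eta g k) i * (pgd gamma eta g k i - z i)
    + sqdist (pgd gamma eta g T) z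
    <= sqdist (pgd gamma eta g 0) z + eta ^+ 2 * (T%:R * (p%:R * G ^+ 2)).
  have D0 : 0 <= sqdist (pgd gamma eta g T) z by apply: sumr_ge0 => i _; exact: sqr_ge0.
  have e2 : 0 < 2 * eta by rewrite mulr_gt0.
  rewrite -(ler_pM2l e2).
  have -> : 2 * eta * (gamma ^+ 2 / (2 * eta) + eta / 2 * (T%:R * (p%:R * G ^+ 2)))
      = gamma ^+ 2 + eta ^+ 2 * (T%:R * (p%:R * G ^+ 2)) by field; rewrite gt_eqF.
  lra.
elim: T => [|T IH]; first by rewrite big_ord0 mulr0 add0r mul0r mulr0 addr0.
rewrite big_ord_recr /=.
set x := pgd gamma eta g T in IH *; set S := \sum_(k < T) _ in IH *.
set w := \sum_i _ * _.
have step : sqdist (pgd gamma eta g T.+1) z <= sqdist x z - 2 * eta * w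
    + eta ^+ 2 * (p%:R * G ^+ 2).
  apply: le_trans (proj_l1_nonexpansive _ g0 zg) _.
  apply: (@le_trans _ _ (sqdist x z - 2 * eta * w + eta ^+ 2 * \sum_i (g x i) ^+ 2)).
    rewrite le_eqVlt; apply/orP; left; apply/eqP.
    rewrite /sqdist /w !mulr_sumr -sumrB -big_split; apply: eq_bigr => i _ /=.
    by rewrite ffunE -/x; ring.
  rewrite lerD2l ler_wpM2l ?sqr_ge0 //.
  apply: (@le_trans _ _ (\sum_(i < p) G ^+ 2)); last by rewrite sumr_const card_ord mulr_natl.
  apply: ler_sum => i _; rewrite -real_normK ?num_real //.
  have Gi := Hg x i (pgd_l1norm eta g T g0).
  by apply: lerXn2r; rewrite // nnegrE //; apply: le_trans Gi.
have -> : T.+1%:R = T%:R + 1 :> R by rewrite -addn1 natrD.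
by lra.
Qed.

End ProjectedGradient.

(** * The approximate gradient *)

Section GradientApproximation.
Context {R : realType} {p : nat}.
Variables (th : 'I_p -> 'I_p -> R) (h : 'I_p -> R) (gamma : R) (d : nat).
Variable mhat : {set 'I_p} -> R.
Hypothesis mhat_le1 : forall K, `|mhat K| <= 1.
Implicit Types (x : {ffun 'I_p -> R}) (u v : 'I_p).

Let mu := ising_mu th h.

Definition gradpoly u v x : mlpoly R p :=
  mlmul (if v == u then mlX R [set u]%SET else mlX R [set u; v]%SET) (Pd d (Epoly u x)).

(** The norm of P_d(E) is at most the truncated exponential series at gamma, and the monomial factor
    has norm 1. *)
Lemma mlnorm_gradpoly u v x : l1norm x <= gamma -> mlnorm (gradpoly u v x) <= expR gamma.
Proof.
move=> xg; apply: le_trans (mlnorm_mul _ _) _.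
have -> : mlnorm (if v == u then mlX R [set u]%SET else mlX R [set u; v]%SET) = 1.
  by case: ifP => _; rewrite mlnorm_X.
have x0 : 0 <= l1norm x by exact: sumr_ge0.
rewrite mul1r; apply: le_trans (mlnorm_Pd _ _) _.
apply: le_trans (expR_partial_le d.+1 (le_trans x0 xg)); apply: ler_sum => k _.
rewrite ler_wpM2r ?invr_ge0 // lerXn2r ?nnegrE ?mlnorm_ge0 ?(le_trans x0) //.
exact: le_trans (mlnorm_Epoly _ _) xg.
Qed.

Lemma normr_hatE_le m c (f : {set 'I_p} -> R) (q : mlpoly R p) :
  (forall K : {set 'I_p}, (#|K| <= m)%N -> `|f K| <= c) -> `|hatE m f q| <= mlnorm q * c.
Proof.
move=> fc; apply: le_trans (ler_norm_sum _ _ _) _.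
rewrite /mlnorm mulr_suml [leRHS](bigID (fun K : {set 'I_p} => (#|K| <= m)%N)) /=.
(* The empty set always qualifies, which forces [c] to be nonnegative. *)
have c0 : 0 <= c by apply: le_trans (fc finset.set0 _); rewrite ?cards0.
rewrite -[leLHS]addr0 lerD // ?sumr_ge0 // => [|K _]; last by rewrite mulr_ge0.
by apply: ler_sum => K Km; rewrite normrM ler_wpM2l // fc.
Qed.

Lemma approx_grad_le u v x : l1norm x <= gamma -> `|approx_grad d mhat u x v| <= expR gamma.
Proof.
move=> xg; rewrite ffunE normrN -/(gradpoly u v x).
apply: le_trans (normr_hatE_le (c := 1) _ _) _ => //.
by rewrite mulr1 mlnorm_gradpoly.
Qed.

(** Both sides are compared with the exact expectation of the polynomial: the moment error is
    amplified by the coefficient norm, and the truncation error is the pointwise Taylor remainder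
    averaged over [mu]. *)
Lemma approx_grad_error u v x t :
  (forall K : {set 'I_p}, (#|K| <= moment_order d)%N -> `|mhat K - \sum_s mu s * sigmaK R K s| <= t) ->
  l1norm x <= gamma -> 3 * gamma <= (d.+1)%:R ->
  `|approx_grad d mhat u x v - screening_grad th h u x v|
  <= expR gamma * t + 3 / 2 * (gamma ^+ d.+1 / ((d.+1)`!)%:R).
Proof.
move=> Hm xg gd; set q := gradpoly u v x; set rem := 3 / 2 * _.
have t0 : 0 <= t by apply: le_trans (Hm finset.set0 _); rewrite ?cards0.
pose mom K := \sum_s mu s * sigmaK R K s.
have E1 : `|hatE (moment_order d) mhat q - \sum_s mu s * mleval q s| <= expR gamma * t.
  (* Cutting at [moment_order d] loses nothing, since the coefficients of larger sets vanish. *)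
  have -> : \sum_s mu s * mleval q s = hatE (moment_order d) mom q.
    rewrite /mleval; under eq_bigr do rewrite mulr_sumr.
    rewrite exchange_big /= /hatE [RHS]big_mkcond; apply: eq_bigr => K _.
    case: ifPn => [_|Km]; first by rewrite mulr_sumr; apply: eq_bigr => s _; ring.
    have -> : q K = 0.
      by apply/eqP; apply: contraNT Km => /moment_order_bound.
    by rewrite big1 // => s _; rewrite mul0r mulr0.
  have -> : hatE (moment_order d) mhat q - hatE (moment_order d) mom q =
      hatE (moment_order d) (fun K => mhat K - mom K) q.
    by rewrite /hatE -sumrB; apply: eq_bigr => K _; rewrite mulrBr.
  apply: le_trans (normr_hatE_le (c := t) _ _) _ => //.
  by rewrite ler_wpM2r // mlnorm_gradpoly.
have E2 : `|\sum_s mu s * mleval q s - \sum_s mu s * (tau u v s * expR (- energy u x s))| <= rem.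
  rewrite -sumrB; apply: le_trans (ler_norm_sum _ _ _) _.
  apply: (@le_trans _ _ (\sum_s mu s * rem)); last first.
    by rewrite -mulr_suml ising_mu_sum mul1r.
  apply: ler_sum => s _; have mu0 : 0 <= mu s by apply/ltW/ising_mu_gt0.
  rewrite -mulrBr normrM (ger0_norm mu0) ler_wpM2l //.
  rewrite /q /gradpoly mleval_mul mleval_tau mleval_Pd mleval_Epoly -mulrBr normrM.
  rewrite normr_tau mul1r distrC; apply: expR_taylor_remainder gd.
  by rewrite normrN (le_trans (normr_energy _ _ _)).
rewrite ffunE -/(gradpoly u v x) -/q /screening_grad -/mu.
rewrite -opprB opprK addrC normrN.
apply: le_trans (lerD E1 E2).
apply: le_trans (ler_normD _ _).
by rewrite addrA subrK.
Qed.

End GradientApproximation.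

(** * Error of the averaged iterate for fixed moment estimates *)

Section Algorithm.
Context {R : realType} {p : nat}.
Variables (th : 'I_p -> 'I_p -> R) (h : 'I_p -> R) (gamma : R) (d : nat).
Hypothesis hsym : forall u v, th u v = th v u.
Hypothesis hwidth : l1_width_le th h gamma.
Variable mhat : {set 'I_p} -> R.
Hypothesis mhat_le1 : forall K, `|mhat K| <= 1.

(** Quadratic growth turns parameter error into suboptimality, which convexity bounds by the average
    regret. Using the approximate gradient costs 2 gamma xi, as iterates and true parameters both
    lie in the l1 ball. *)
Lemma alg1_error_bound (eta xi : R) (T : nat) (u v : 'I_p) : v != u ->
  0 <= gamma -> 0 < eta -> (0 < T)%N ->
  (forall x w, l1norm x <= gamma ->
    `|approx_grad d mhat u x w - screening_grad th h u x w| <= xi) ->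
  (alg1_output d gamma eta T mhat u v - th u v) ^+ 2
     * (expR (- (3 * gamma)) / (2 * (1 + gamma)))
  <= gamma ^+ 2 / (2 * eta * T%:R) + eta / 2 * (p%:R * expR gamma ^+ 2) + 2 * gamma * xi.
Proof.
move=> vu g0 e0 T0 Hxi; set out := alg1_output _ _ _ _ _ _; set t := local_param th h u.
have T0' : 0 < T%:R :> R by rewrite ltr0n.
pose x k := pgd gamma eta (approx_grad d mhat u) k.
have outE w : out w = T%:R^-1 * \sum_(k < T) x k w by rewrite ffunE.
have xg k : l1norm (x k) <= gamma by exact: pgd_l1norm.
have tg : l1norm t <= gamma by exact: l1norm_local_param.
have outg : l1norm out <= gamma.
  apply: (@le_trans _ _ (T%:R^-1 * \sum_(k < T) l1norm (x k))).
    rewrite /l1norm exchange_big mulr_sumr; apply: ler_sum => w _.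
    by rewrite outE normrM ger0_norm ?invr_ge0 // ler_wpM2l ?invr_ge0 // ler_norm_sum.
  rewrite mulrC ler_pdivrMr //; apply: (@le_trans _ _ (\sum_(k < T) gamma)).
    by apply: ler_sum => k _.
  by rewrite sumr_const card_ord mulr_natr.
apply: le_trans (screening_strong_convexity hsym hwidth vu outg) _.
(* Jensen's inequality from the supporting plane at [out]: the linear terms sum to 0 because [out]
   is the mean of the iterates. *)
have jensen : T%:R * screening th h u out <= \sum_(k < T) screening th h u (x k).
  have H : \sum_(k < T) (screening th h u out +
      \sum_w screening_grad th h u out w * (x k w - out w))
      <= \sum_(k < T) screening th h u (x k).
    by apply: ler_sum => k _; exact: screening_subgrad.
  apply: le_trans H; rewrite big_split /= sumr_const card_ord mulr_natl.
  rewrite exchange_big /= big1 ?addr0 // => w _.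
  rewrite -mulr_sumr sumrB sumr_const card_ord -[_ *+ T]mulr_natl outE.
  by rewrite mulVKf ?gt_eqF // subrr mulr0.
have reg k : screening th h u (x k) - screening th h u t <=
    \sum_w approx_grad d mhat u (x k) w * (x k w - t w) + 2 * gamma * xi.
  have := screening_subgrad th h u (x k) t.
  set G := \sum_w screening_grad _ _ _ _ _ * _ => HG.
  have -> : \sum_w approx_grad d mhat u (x k) w * (x k w - t w) =
     - G + \sum_w (approx_grad d mhat u (x k) w - screening_grad th h u (x k) w)
       * (x k w - t w).
    by rewrite /G -sumrN -big_split; apply: eq_bigr => w _ /=; ring.
  set E := \sum_w _ * _.
  have : `|E| <= 2 * gamma * xi.
    apply: le_trans (ler_norm_sum _ _ _) _.
    have xi0 : 0 <= xi by apply: le_trans (Hxi t u tg).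
    apply: (@le_trans _ _ (\sum_w xi * (`|x k w| + `|t w|))).
      apply: ler_sum => w _; rewrite normrM; apply: ler_pM => //; first exact: Hxi.
      exact: ler_normB.
    rewrite -mulr_sumr mulrC ler_wpM2r // big_split /=.
    by apply: le_trans (lerD (xg k) tg) _; lra.
  by rewrite ler_norml => /andP[E1 _]; lra.
have regsum := @pgd_regret R p gamma eta (expR gamma) (approx_grad d mhat u) t T g0 e0 tg
  (fun y w yg => approx_grad_le d mhat_le1 u w yg).
have S : \sum_(k < T) (screening th h u (x k) - screening th h u t) <=
   gamma ^+ 2 / (2 * eta) + eta / 2 * (T%:R * (p%:R * expR gamma ^+ 2))
   + T%:R * (2 * gamma * xi).
  apply: (@le_trans _ _ (\sum_(k < T)
    (\sum_w approx_grad d mhat u (x k) w * (x k w - t w) + 2 * gamma * xi))).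
    by apply: ler_sum => k _; exact: reg.
  by rewrite big_split /= [X in _ + X]sumr_const card_ord -[_ *+ T]mulr_natl lerD2r.
rewrite -(ler_pM2l T0') mulrBr; move: S.
rewrite sumrB sumr_const card_ord -[_ *+ T]mulr_natl => S.
have -> : T%:R * (gamma ^+ 2 / (2 * eta * T%:R) + eta / 2 * (p%:R * expR gamma ^+ 2)
    + 2 * gamma * xi) = gamma ^+ 2 / (2 * eta) + eta / 2 * (T%:R * (p%:R * expR gamma ^+ 2))
   + T%:R * (2 * gamma * xi) by field; rewrite !gt_eqF.
by lra.
Qed.

End Algorithm.

(** * Choice of the step size, the number of iterations and the degree *)

Lemma le_nat_ceil {R : realType} (n : nat) (x : R) : n%:Z = Num.ceil x -> x <= n%:R.
Proof. by move=> E; have := ceil_ge x; rewrite -E. Qed.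

(** Here [a] stands for e^gamma, which makes the identities rational. With r = sqrt(p T), the two
    terms are gamma a r / T times 3/4 and 1/3, and 3/4 + 1/3 is rounded up to 3/2. *)
Lemma pgd_step_rate {R : realType} (p T : nat) (gamma a eps eta : R) :
  (0 < p)%N -> 0 < gamma -> 0 < a -> 0 < eps ->
  576 * p%:R * gamma ^+ 2 * a ^+ 8 * (1 + gamma) ^+ 2 / eps ^+ 4 <= T%:R ->
  eta = 2 * gamma * a^-1 / (3 * Num.sqrt (p%:R * T%:R)) ->
  [/\ (0 < T)%N, 0 < eta &
  gamma ^+ 2 / (2 * eta * T%:R) + eta / 2 * (p%:R * a ^+ 2)
    <= eps ^+ 2 * a^-1 ^+ 3 / (1 + gamma) / 16].
Proof.
move=> p0 g0 a0 e0 HT ->.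
have p0' : 0 < p%:R :> R by rewrite ltr0n.
have g1 : 0 < 1 + gamma by exact: addr_gt0.
have T0' : 0 < T%:R :> R.
  apply: lt_le_trans HT; apply: divr_gt0; last exact: exprn_gt0.
  by do 4 (apply: mulr_gt0; last by rewrite ?ltr0n ?exprn_gt0); rewrite ltr0n.
have T0 : (0 < T)%N by rewrite -(ltr0n R).
set r := Num.sqrt _; have r0 : 0 < r by rewrite sqrtr_gt0 mulr_gt0.
have r2 : r ^+ 2 = p%:R * T%:R by rewrite sqr_sqrtr // ltW // mulr_gt0.
split => //; first by rewrite divr_gt0 ?mulr_gt0 ?invr_gt0.
(* The lower bound on [T] says precisely p <= c^2 T, whence r <= c T; the 24 comes from 576 =
   24^2. *)
pose c := eps ^+ 2 / (24 * gamma * a ^+ 4 * (1 + gamma)).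
have c0 : 0 < c by rewrite divr_gt0 ?exprn_gt0 // !mulr_gt0 ?exprn_gt0.
have rT : r <= c * T%:R.
  have cT0 : 0 < c * T%:R by exact: mulr_gt0.
  rewrite -(@ler_pXn2r _ 2) ?nnegrE ?(ltW r0) ?(ltW cT0) //.
  rewrite r2 exprMn [T%:R ^+ 2]expr2 mulrA ler_pM2r //.
  apply: le_trans (ler_wpM2l (sqr_ge0 c) HT).
  rewrite le_eqVlt; apply/orP; left; apply/eqP; rewrite /c; field.
  by rewrite !gt_eqF.
have -> : gamma ^+ 2 / (2 * (2 * gamma * a^-1 / (3 * r)) * T%:R)
   + 2 * gamma * a^-1 / (3 * r) / 2 * (p%:R * a ^+ 2)
   = gamma * a * (3 / 4 * (r / T%:R) + (p%:R / r) / 3).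
  by field; rewrite !gt_eqF.
have -> : p%:R / r = r / T%:R.
  have -> : p%:R = r ^+ 2 / T%:R by rewrite r2 mulfK ?gt_eqF.
  by field; rewrite !gt_eqF.
have rc : r / T%:R <= c by rewrite ler_pdivrMr.
have rT0 : 0 <= r / T%:R by rewrite divr_ge0 ?ltW.
apply: (@le_trans _ _ (gamma * a * (3 / 2 * c))).
  by rewrite ler_pM2l ?mulr_gt0 //; lra.
rewrite le_eqVlt; apply/orP; left; apply/eqP; rewrite /c; field.
by rewrite !gt_eqF.
Qed.

Section Accuracy.
Context {R : realType} {p : nat}.
Variables (th : 'I_p -> 'I_p -> R) (h : 'I_p -> R) (gamma eps : R) (d T : nat).
Hypothesis hsym : forall u v, th u v = th v u.
Hypothesis hwidth : l1_width_le th h gamma.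
Hypotheses (g_gt0 : 0 < gamma) (e_gt0 : 0 < eps) (e_le : eps <= 4 * gamma).

Let L := ln (16 * gamma * (1 + gamma) / eps ^+ 2).

(** The deterministic core: randomness enters only through the two hypotheses on [mhat]. *)
Lemma alg1_accuracy (mhat : {set 'I_p} -> R) (eta : R) (u v : 'I_p) :
  (d%:Z = Num.ceil ((3 * gamma + L) /
      LambertW (3 / expR 1 + (gamma * expR 1)^-1 * L)) - 1)%R ->
  576 * p%:R * gamma ^+ 2 * expR (8 * gamma) * (1 + gamma) ^+ 2 / eps ^+ 4 <= T%:R ->
  eta = 2 * gamma * expR (- gamma) / (3 * Num.sqrt (p%:R * T%:R)) ->
  (forall K, `|mhat K| <= 1) ->
  (forall K : {set 'I_p}, (#|K| <= moment_order d)%N ->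
    `|mhat K - \sum_s ising_mu th h s * sigmaK R K s|
    <= eps ^+ 2 / (8 * gamma * (1 + gamma) * expR (4 * gamma))) ->
  v != u -> `|alg1_output d gamma eta T mhat u v - th u v| <= eps.
Proof.
move=> Hd HT Heta m1 Hm vu.
have g1 : 0 < 1 + gamma by exact: addr_gt0.
(* From [eps <= 4 * gamma] follows eps^2 <= 16 gamma^2 <= 16 gamma (1 + gamma). *)
have L0 : 0 <= L.
  have : eps ^+ 2 <= (4 * gamma) ^+ 2.
    by apply: lerXn2r => //; rewrite nnegrE ?mulr_ge0 // ltW.
  move=> e2; apply: ln_ge0; rewrite ler_pdivlMr ?exprn_gt0 // mul1r.
  apply: le_trans e2 _; rewrite -subr_ge0.
  have -> : 16 * gamma * (1 + gamma) - (4 * gamma) ^+ 2 = 16 * gamma by ring.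
  by rewrite mulr_ge0 // ltW.
have expL : expR (- L) = eps ^+ 2 / (16 * gamma * (1 + gamma)).
  rewrite expRN lnK ?posrE ?invf_div // divr_gt0 ?exprn_gt0 //.
  by rewrite !mulr_gt0.
(* The ceiling equals [d + 1], the index of the first omitted Taylor term. *)
have [gd Hfact] : 3 * gamma <= (d.+1)%:R /\
    gamma ^+ d.+1 / ((d.+1)`!)%:R <= expR (- (3 * gamma + L)).
  apply: taylor_degree => //; apply: le_nat_ceil.
  by rewrite -addn1 PoszD Hd subrK.
have a0 := expR_gt0 gamma; set a := expR gamma in a0.
have ea k : expR (k%:R * gamma) = a ^+ k by rewrite expRM_natl.
have eVa k : expR (- (k%:R * gamma)) = a^-1 ^+ k by rewrite expRN ea exprVn.
have p0 : (0 < p)%N by case: p u {vu} => [[]|].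
rewrite (ea 8%N) in HT; rewrite (ea 4%N) in Hm; rewrite expRN -/a in Heta.
have [T0 eta0 Hopt] := pgd_step_rate p0 g_gt0 a0 e_gt0 HT Heta.
pose B := eps ^+ 2 * a^-1 ^+ 3 / (1 + gamma).
(* In units of B / (32 gamma), the moments contribute 4 and the Taylor remainder 3. *)
have Hg x w (xg : l1norm x <= gamma) :
    `|approx_grad d mhat u x w - screening_grad th h u x w| <= 7 * B / (32 * gamma).
  apply: le_trans (approx_grad_error _ _ Hm xg gd) _.
  have -> : 7 * B / (32 * gamma) = a * (eps ^+ 2 / (8 * gamma * (1 + gamma) * a ^+ 4))
     + 3 / 2 * (a^-1 ^+ 3 * (eps ^+ 2 / (16 * gamma * (1 + gamma)))).
    by rewrite /B; field; rewrite !gt_eqF.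
  rewrite lerD2l ler_wpM2l ?divr_ge0 //; apply: le_trans Hfact _.
  by rewrite opprD expRD (eVa 3%N) expL.
have := alg1_error_bound hsym hwidth m1 vu (ltW g_gt0) eta0 T0 Hg.
rewrite -/a (eVa 3%N) => H.
have {}H : (alg1_output d gamma eta T mhat u v - th u v) ^+ 2 *
    (a^-1 ^+ 3 / (2 * (1 + gamma))) <= eps ^+ 2 * (a^-1 ^+ 3 / (2 * (1 + gamma))).
  apply: le_trans H _; rewrite -/B in Hopt.
  have -> : eps ^+ 2 * (a^-1 ^+ 3 / (2 * (1 + gamma))) = B / 16 + 7 * B / 16.
    by rewrite /B; field; rewrite !gt_eqF.
  have -> : 2 * gamma * (7 * B / (32 * gamma)) = 7 * B / 16 by field; rewrite gt_eqF.
  by rewrite lerD2r.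
move: H; rewrite ler_pM2r; last first.
  apply: divr_gt0; last exact: mulr_gt0.
  by apply: exprn_gt0; rewrite invr_gt0.
rewrite -[leLHS]real_normK ?num_real // ler_pXn2r // nnegrE ?ltW //.
Qed.

End Accuracy.

(** * Concentration of the empirical moments *)

Section Hoeffding.
Context {R : realType}.

(** As [f] takes only the values 1 and -1, exp(l f) is affine in [f], so its mean depends on [mu]
    only through [m]. *)
Lemma mgf_spin {C : finType} (mu f : C -> R) (l : R) :
  (forall s, 0 <= mu s) -> \sum_s mu s = 1 -> (forall s, `|f s| = 1) -> 0 <= l ->
  \sum_s mu s * expR (l * (f s - \sum_c mu c * f c)) <= expR (l ^+ 2 / 2).
Proof.
move=> mu0 mu1 f1 l0; set m := \sum_c mu c * f c.
have m1 : -1 <= m <= 1.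
  rewrite -ler_norml; apply: le_trans (ler_norm_sum _ _ _) _; rewrite -mu1.
  by apply: ler_sum => s _; rewrite normrM f1 mulr1 ger0_norm.
have fE s : expR (l * f s) = (1 + f s) / 2 * expR l + (1 - f s) / 2 * expR (- l).
  have := f1 s; have [f0|f0] := leP 0 (f s).
    by rewrite ger0_norm // => ->; rewrite mulr1; field.
  by rewrite ltr0_norm // => /(canRL (@opprK R)) ->; rewrite mulrN1; field.
have -> : \sum_s mu s * expR (l * (f s - m)) = expR (- (l * m)) *
    ((1 + m) / 2 * expR l + (1 - m) / 2 * expR (- l)).
  have -> : (1 + m) / 2 * expR l + (1 - m) / 2 * expR (- l) = \sum_s mu s * expR (l * f s).
    transitivity (\sum_s mu s * ((expR l + expR (- l)) / 2)
        + \sum_s mu s * f s * ((expR l - expR (- l)) / 2)).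
      by rewrite -!mulr_suml mu1 -/m; field.
    by rewrite -big_split; apply: eq_bigr => s _ /=; rewrite fE; field.
  rewrite mulr_sumr; apply: eq_bigr => s _.
  by rewrite mulrBr addrC expRD; ring.
apply: le_trans (ler_wpM2l (expR_ge0 _) (hoeffding_spin m1 l0)) _.
by rewrite -expRD addKr.
Qed.

(** Chernoff's method with parameter [t], which minimises - n l t + n l^2 / 2 over l. Probabilities
    are finite sums over tuples, so independence becomes distributivity of products over sums. *)
Lemma hoeffding_upper {C : finType} (mu f : C -> R) (n : nat) (t : R) :
  (forall s, 0 <= mu s) -> \sum_s mu s = 1 -> (forall s, `|f s| = 1) -> 0 <= t ->
  \sum_(s : {ffun 'I_n -> C} | n%:R * t <= \sum_j (f (s j) - \sum_c mu c * f c))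
     \prod_j mu (s j) <= expR (- (n%:R * t ^+ 2 / 2)).
Proof.
move=> mu0 mu1 f1 t0; set m := \sum_c mu c * f c.
pose W (s : {ffun 'I_n -> C}) := \prod_j (mu (s j) * expR (t * (f (s j) - m))).
have W0 s : 0 <= W s by apply: prodr_ge0 => j _; rewrite mulr_ge0 ?expR_ge0.
apply: (@le_trans _ _ (\sum_s expR (- (n%:R * t ^+ 2)) * W s)).
  rewrite big_mkcond; apply: ler_sum => s _; case: ifP => [Hs|_]; last first.
    by rewrite mulr_ge0 ?expR_ge0.
  rewrite /W big_split /= mulrCA -[leLHS]mulr1 ler_wpM2l ?prodr_ge0 //.
  rewrite -expR_sum -expRD -[leLHS]expR0 ler_expR -mulr_sumr.
  have := ler_wpM2l t0 Hs; lra.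
rewrite -mulr_sumr -(bigA_distr_bigA (fun (j : 'I_n) c => mu c * expR (t * (f c - m)))) /=.
rewrite prodr_const card_ord.
apply: (@le_trans _ _ (expR (- (n%:R * t ^+ 2)) * expR (t ^+ 2 / 2) ^+ n)).
  rewrite ler_wpM2l ?expR_ge0 // lerXn2r ?nnegrE ?expR_ge0 ?mgf_spin //.
  by apply: sumr_ge0 => s _; rewrite mulr_ge0 ?expR_ge0.
by rewrite -expRM_natl -expRD ler_expR; lra.
Qed.

(** The two-sided event lies in the union of the one-sided events for [f] and for its negation. *)
Lemma hoeffding_mean {C : finType} (mu f : C -> R) (n : nat) (t : R) :
  (forall s, 0 <= mu s) -> \sum_s mu s = 1 -> (forall s, `|f s| = 1) -> 0 <= t -> (0 < n)%N ->
  \sum_(s : {ffun 'I_n -> C} | t < `|n%:R^-1 * \sum_j f (s j) - \sum_c mu c * f c|)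
     \prod_j mu (s j) <= 2 * expR (- (n%:R * t ^+ 2 / 2)).
Proof.
move=> mu0 mu1 f1 t0 n0; set m := \sum_c mu c * f c.
have n0' : 0 < n%:R :> R by rewrite ltr0n.
have up := @hoeffding_upper C mu f n t mu0 mu1 f1 t0.
have f1' s : `|- f s| = 1 by rewrite normrN.
have lo := @hoeffding_upper C mu (fun s => - f s) n t mu0 mu1 f1' t0.
rewrite mulr_natl mulr2n; apply: le_trans (lerD up lo).
rewrite big_mkcond [X in _ <= X + _]big_mkcond [X in _ <= _ + X]big_mkcond -big_split /=.
apply: ler_sum => s _; set w := \prod_j _.
have w0 : 0 <= w by apply: prodr_ge0.
set S := \sum_j f (s j).
have -> : \sum_j (f (s j) - \sum_c mu c * f c) = S - n%:R * m.
  by rewrite sumrB sumr_const card_ord mulr_natl.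
have -> : \sum_j (- f (s j) - \sum_c mu c * - f c) = - (S - n%:R * m).
  have -> : \sum_c mu c * - f c = - m by rewrite -sumrN; apply: eq_bigr => c _; rewrite mulrN.
  by rewrite sumrB sumr_const card_ord sumrN -/S mulNrn opprK opprB addrC mulr_natl.
case: ifP => [Ht|_]; last by apply: addr_ge0; case: ifP.
have : n%:R * t <= `|S - n%:R * m|.
  have -> : S - n%:R * m = n%:R * (n%:R^-1 * S - m) by field; rewrite gt_eqF.
  by rewrite normrM (ger0_norm (ltW n0')) ler_pM2l // ltW.
rewrite ler_normr => /orP[-> | ->]; first by rewrite lerDl; case: ifP.
by rewrite lerDr; case: ifP.
Qed.

End Hoeffding.

(** * Events determined by finitely many finite-valued variables *)

Section FiniteValued.
Context {R : realType} {dsp : measure_display} {Omega : measurableType dsp}.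

Lemma measurable_finite_preimage {C : finType} (F : Omega -> C) :
  (forall c, measurable (F @^-1` [set c])) -> forall A : set C, measurable (F @^-1` A).
Proof.
move=> HF A; have -> : F @^-1` A = \bigcup_(c in A) (F @^-1` [set c]).
  apply/seteqP; split => [w Aw|w [c Ac /= ->//]]; by exists (F w).
by apply: fin_bigcup_measurable => // c _.
Qed.

Lemma measurable_ffun_eq {I C : finType} (F : I -> Omega -> C) (g : I -> C) :
  (forall i c, measurable (F i @^-1` [set c])) ->
  measurable [set w | forall i, F i w = g i].
Proof.
move=> HF; have -> : [set w | forall i, F i w = g i] = \bigcap_(i in setT) (F i @^-1` [set g i]).
  by apply/seteqP; split => [w Hw i _|w Hw i]; [exact: Hw | exact: (Hw i Logic.I)].
by apply: fin_bigcap_measurable => // i _.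
Qed.

Lemma measurable_ffun_preimage {I C : finType} (F : I -> Omega -> C) :
  (forall i c, measurable (F i @^-1` [set c])) ->
  forall A : set {ffun I -> C}, measurable [set w | A [ffun i => F i w]].
Proof.
move=> HF; apply: (@measurable_finite_preimage _ (fun w => [ffun i => F i w])) => g.
rewrite (_ : _ @^-1` _ = [set w | forall i, F i w = g i]); first exact: measurable_ffun_eq.
apply/seteqP; split => w /=; first by move=> <- i; rewrite ffunE.
by move=> H; apply/ffunP => i; rewrite ffunE.
Qed.

Variable P : probability Omega R.

(** Measurability is carried through the induction because subadditivity requires it at each
    step. *)
Lemma finite_union_bound {I : finType} (Q : pred I) (A : I -> set Omega) :
  (forall i, Q i -> measurable (A i)) ->
  measurable [set w | exists2 i, Q i & A i w] /\
  (P [set w | exists2 i, Q i & A i w] <= \sum_(i | Q i) P (A i))%E.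
Proof.
move=> HA.
have -> : [set w | exists2 i, Q i & A i w] = \big[setU/set0]_(i <- index_enum I | Q i) A i.
  rewrite -bigcup_seq_cond; apply/seteqP; split => [w [i Qi Aiw]|w [i] /=].
    by exists i => //=; rewrite mem_index_enum.
  by move=> /andP[_ Qi] Aiw; exists i.
elim: (index_enum I) => [|i r [mr IH]].
  by rewrite !big_nil measure0; split.
rewrite !big_cons; case: ifP => // Qi; split.
  by apply: measurableU => //; exact: HA.
apply: le_trans (measureU2 P (HA i Qi) mr) _.
by rewrite leeD2l.
Qed.

(** The event is a finite union over the tuples in [S], whose probabilities [iid_samples] provides;
    subadditivity suffices for an upper bound. *)
Lemma iid_prob_le {p n : nat} (Y : 'I_n -> Omega -> config p) (mu : config p -> R)
    (S : pred {ffun 'I_n -> config p}) :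
  iid_samples P Y mu ->
  measurable [set w | S [ffun j => Y j w]] /\
  (P [set w | S [ffun j => Y j w]] <= (\sum_(s | S s) \prod_j mu (s j))%:E)%E.
Proof.
move=> [Ym Yp]; split.
  exact: (measurable_ffun_preimage Ym (fun s => S s)).
have Hm (s : {ffun 'I_n -> config p}) : S s -> measurable [set w | forall j, Y j w = s j].
  by move=> _; exact: measurable_ffun_eq.
have [mU PU] := finite_union_bound Hm.
have -> : [set w | S [ffun j => Y j w]] = [set w | exists2 s : {ffun 'I_n -> config p},
    S s & forall j, Y j w = s j].
  apply/seteqP; split => [w /= Sw|w [s Ss Hs] /=].
    by exists [ffun j => Y j w] => // j; rewrite ffunE.
  by rewrite (_ : [ffun j => Y j w] = s) //; apply/ffunP => j; rewrite ffunE.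
apply: le_trans PU _; rewrite -sumEFin; apply: lee_sum => s _.
by rewrite Yp.
Qed.

End FiniteValued.

(** * Number of moments and sample size *)

Lemma bin_le_expn n j : ('C(n, j) <= n ^ j)%N.
Proof.
elim: n j => [|n IH] [|j]; rewrite ?bin0 ?bin0n ?expn0 //.
rewrite binS; apply: leq_trans (leq_add (IH j.+1) (IH j)) _.
have H : (n ^ j <= n.+1 ^ j)%N by case: (j) => // k; rewrite leq_exp2r.
by rewrite !expnS mulSn addnC leq_add ?leq_mul.
Qed.

(** At most p^k sets have size k, and each of the [m + 1] sizes costs at most p^m. *)
Lemma card_small_sets p m : (0 < p)%N ->
  (#|[set K : {set 'I_p} | (#|K| <= m)%N]%SET| <= m.+1 * p ^ m)%N.
Proof.
move=> p0; have draws k : (#|[set K : {set 'I_p} | #|K| == k]%SET| <= p ^ k)%N.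
  by rewrite card_draws card_ord bin_le_expn.
elim: m => [|m IH].
  by rewrite mul1n; apply: leq_trans (draws 0%N); apply: subset_leq_card;
    apply/fintype.subsetP => K; rewrite !inE leqn0.
have sub : [set K : {set 'I_p} | (#|K| <= m.+1)%N]%SET \subset
    [set K : {set 'I_p} | (#|K| <= m)%N]%SET :|: [set K : {set 'I_p} | #|K| == m.+1]%SET.
  by apply/fintype.subsetP => K; rewrite !inE leq_eqVlt orbC ltnS.
apply: leq_trans (subset_leq_card sub) _; apply: leq_trans (leq_card_setU _ _) _.
apply: leq_trans (leq_add IH (draws _)) _.
rewrite [in X in (_ <= X)%N]mulSn addnC leq_add2l leq_mul2l /=.
by rewrite leq_pexp2l.
Qed.

(** The choice of [n] gives n t^2 / 2 >= M, and e^(-M) = delta / ((e p)^(d+2) 2 p (d+2)). Against at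
    most (d+3) p^(d+2) sets there remains delta (d+3) / (e^(d+2) p (d+2)), at most delta since p >=
    2. *)
Lemma sample_size_bound {R : realType} (p d n : nat) (a gamma eps delta : R) :
  (2 <= p)%N -> 0 < gamma -> 0 < a -> 0 < eps -> 0 < delta -> delta < 1 ->
  2 ^+ 7 * a ^+ 8 * gamma ^+ 2 * (1 + gamma) ^+ 2 *
    ((d.+2)%:R * ln (expR 1 * p%:R) + ln (2 * p%:R * (d.+2)%:R / delta)) / eps ^+ 4
    <= n%:R ->
  let t := eps ^+ 2 / (8 * gamma * (1 + gamma) * a ^+ 4) in
  (0 < n)%N /\
  (#|[set K : {set 'I_p} | (#|K| <= moment_order d)%N]%SET|)%:R
    * (2 * expR (- (n%:R * t ^+ 2 / 2))) <= delta.
Proof.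
move=> p2 g0 a0 e0 d0 d1; set M := _ * ln _ + ln _ => Hn t.
have p0 : (0 < p)%N by apply: leq_trans p2.
have p0' : 0 < p%:R :> R by rewrite ltr0n.
have p2' : 2 <= p%:R :> R by rewrite ler_nat.
have g1 : 0 < 1 + gamma by exact: addr_gt0.
have D0 : 0 < (d.+2)%:R :> R by rewrite ltr0n.
have e1 : 1 <= expR 1 :> R by apply: le_trans (expR_ge1Dx 1); rewrite lerDl.
have ep0 : 0 < expR 1 * p%:R :> R by rewrite mulr_gt0 ?expR_gt0.
have q0 : 0 < 2 * p%:R * (d.+2)%:R / delta.
  by apply: divr_gt0 => //; apply: mulr_gt0 => //; exact: mulr_gt0.
have M0 : 0 < M.
  apply: ltr_pwDl.
    apply: mulr_gt0 => //; rewrite ln_gt0 //.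
    apply: (@lt_le_trans _ _ p%:R); first by rewrite ltr1n.
    by rewrite ler_peMl // ltW.
  apply: ln_ge0; rewrite ler_pdivlMr // mul1r; apply: ltW; apply: lt_le_trans d1 _.
  have : 1 <= (d.+2)%:R :> R by rewrite ler1n.
  nra.
have n0 : 0 < n%:R :> R.
  apply: lt_le_trans Hn; apply: divr_gt0; last exact: exprn_gt0.
  apply: mulr_gt0 M0; do 3 (apply: mulr_gt0; last by rewrite exprn_gt0).
  by rewrite exprn_gt0.
split; first by rewrite -(ltr0n R).
have Mn : M <= n%:R * t ^+ 2 / 2.
  have t2 : 0 <= t ^+ 2 / 2 by rewrite divr_ge0 ?sqr_ge0.
  rewrite -mulrA; apply: le_trans (ler_wpM2r t2 Hn).
  rewrite le_eqVlt; apply/orP; left; apply/eqP; rewrite /t; field.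
  by rewrite !gt_eqF.
have eM : expR (- M) = delta / ((expR 1 * p%:R) ^+ d.+2 * (2 * p%:R * (d.+2)%:R)).
  rewrite expRN /M expRD expRM_natl !lnK ?posrE // invfM invf_div.
  have := exprn_gt0 d.+2 ep0; set Z := _ ^+ d.+2 => Z0.
  by field; rewrite !gt_eqF.
set N := #|_|.
have HN : N%:R <= (d.+3)%:R * p%:R ^+ d.+2 :> R.
  rewrite -natrX -natrM ler_nat; apply: leq_trans (card_small_sets _ p0) _.
  have md : (moment_order d <= d.+2)%N by exact: leq_subr.
  by apply: leq_mul => //; rewrite leq_pexp2l.
apply: (@le_trans _ _ ((d.+3)%:R * p%:R ^+ d.+2 * (2 * expR (- M)))).
  have h2 : 0 <= 2 * expR (- (n%:R * t ^+ 2 / 2)) by rewrite mulr_ge0 ?expR_ge0.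
  by apply: (ler_pM _ h2 HN) => //; rewrite ler_wpM2l // ler_expR lerN2.
rewrite eM exprMn.
have X0 : 0 < p%:R ^+ d.+2 :> R by exact: exprn_gt0.
have E0 : 1 <= expR 1 ^+ d.+2 :> R by exact: exprn_ege1.
have E0' : 0 < expR 1 ^+ d.+2 :> R by apply: lt_le_trans E0.
have -> : (d.+3)%:R * p%:R ^+ d.+2 * (2 * (delta / (expR 1 ^+ d.+2 * p%:R ^+ d.+2
   * (2 * p%:R * (d.+2)%:R)))) = delta * ((d.+3)%:R / (expR 1 ^+ d.+2 * (p%:R * (d.+2)%:R))).
  by move: X0 E0'; set X := _ ^+ d.+2; set Y := _ ^+ d.+2 => X0 Y0; field; rewrite !gt_eqF.
rewrite -[leRHS]mulr1 ler_pM2l // ler_pdivrMr; last first.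
  by apply: mulr_gt0 => //; exact: mulr_gt0.
rewrite mul1r; apply: (@le_trans _ _ (p%:R * (d.+2)%:R)); last first.
  by rewrite ler_peMl // ltW // mulr_gt0.
apply: (@le_trans _ _ (2 * (d.+2)%:R)); last by rewrite ler_pM2r.
by rewrite -natrM ler_nat mul2n -addnn addSnnS leq_addl.
Qed.

(** Serves measurability of the success event: nothing is assumed about the samples attached to
    larger sets. *)
Lemma alg1_output_ext {R : realType} {p : nat} d (gamma eta : R) T
    (m1 m2 : {set 'I_p} -> R) (u : 'I_p) :
  (forall K : {set 'I_p}, (#|K| <= moment_order d)%N -> m1 K = m2 K) ->
  alg1_output d gamma eta T m1 u = alg1_output d gamma eta T m2 u.
Proof.
move=> Hm; have Hg x : approx_grad d m1 u x = approx_grad d m2 u x.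
  apply/ffunP => v; rewrite !ffunE /hatE; congr (- _).
  by apply: eq_bigr => K Km; rewrite Hm.
pose step m (x : {ffun 'I_p -> R}) :=
  proj_l1 gamma [ffun i => x i - eta * approx_grad d m u x i].
have Hs : step m1 = step m2 by apply/funext => x; rewrite /step Hg.
have Hit k : alg1_iterate d gamma eta m1 u k = alg1_iterate d gamma eta m2 u k.
  by rewrite -[LHS]/(iter k (step m1) [ffun=> 0]) Hs.
by apply/ffunP => i; rewrite !ffunE; congr (_ * _); apply: eq_bigr => k _; rewrite Hit.
Qed.

Lemma emp_moments_le1 {R : realType} {p n : nat} {T : Type}
    (X : {set 'I_p} -> 'I_n -> T -> config p) w K : `|emp_moments R X w K| <= 1.
Proof.
rewrite /emp_moments normrM ger0_norm ?invr_ge0 //.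
apply: (@le_trans _ _ (n%:R^-1 * n%:R)); last first.
  (* For [n = 0] the inverse is 0 by convention, and so is the product. *)
  by case: n {X} => [|n]; rewrite ?mulr0 // mulVf.
rewrite ler_wpM2l ?invr_ge0 //; apply: le_trans (ler_norm_sum _ _ _) _.
by under eq_bigr do rewrite normr_sigmaK; rewrite sumr_const card_ord.
Qed.

Lemma emp_moment_deviation {R : realType} {p n : nat} {dsp : measure_display}
    {Omega : measurableType dsp} (P : probability Omega R)
    (X : {set 'I_p} -> 'I_n -> Omega -> config p) (mu : config p -> R) (K : {set 'I_p}) (t : R) :
  (forall s, 0 <= mu s) -> \sum_s mu s = 1 -> (0 < n)%N -> 0 <= t ->
  iid_samples P (X K) mu ->
  measurable [set w | t < `|emp_moments R X w K - \sum_s mu s * sigmaK R K s|] /\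
  (P [set w | (t < `|emp_moments R X w K - \sum_s mu s * sigmaK R K s|)%R]
    <= (2 * expR (- (n%:R * t ^+ 2 / 2)))%:E)%E.
Proof.
move=> mu0 mu1 n0 t0 HX; set B := [set w | _].
pose S (s : {ffun 'I_n -> config p}) :=
  t < `|n%:R^-1 * \sum_j sigmaK R K (s j) - \sum_c mu c * sigmaK R K c|.
have -> : B = [set w | S [ffun j => X K j w]].
  have E w : emp_moments R X w K = n%:R^-1 * \sum_j sigmaK R K ([ffun j => X K j w] j).
    by congr (_ * _); apply: eq_bigr => j _; rewrite ffunE.
  by apply/seteqP; split => w; rewrite /B /S /= E.
have [mB PB] := iid_prob_le S HX; split => //.
apply: le_trans PB _; rewrite lee_fin.
exact: (hoeffding_mean mu0 mu1 (normr_sigmaK K) t0 n0).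
Qed.

Theorem theorem1 (R : realType) (p : nat) (hp : (2 <= p)%N) (gamma : R) (hgamma : 0 < gamma)
  (th : 'I_p -> 'I_p -> R) (h : 'I_p -> R) (hsym : forall u v, th u v = th v u)
  (hwidth : l1_width_le th h gamma)
  (eps delta : R) (heps : 0 < eps) (heps4 : eps <= 4 * gamma)
  (hdelta0 : 0 < delta) (hdelta1 : delta < 1)
  (d T n : nat) (eta : R)
  (Hd : (d%:Z = Num.ceil ((3 * gamma + ln (16 * gamma * (1 + gamma) / eps ^+ 2)) /
            LambertW (3 / expR 1 + (gamma * expR 1)^-1 *
                        ln (16 * gamma * (1 + gamma) / eps ^+ 2))) - 1)%R)
  (HT : (T%:Z = Num.ceil (576 * p%:R * gamma ^+ 2 * expR (8 * gamma) * (1 + gamma) ^+ 2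
                           / eps ^+ 4))%R)
  (Heta : eta = 2 * gamma * expR (- gamma) / (3 * Num.sqrt (p%:R * T%:R)))
  (Hn : (n%:Z = Num.ceil (2 ^+ 7 * expR (8 * gamma) * gamma ^+ 2 * (1 + gamma) ^+ 2 *
            ((d.+2)%:R * ln (expR 1 * p%:R) + ln (2 * p%:R * (d.+2)%:R / delta))
            / eps ^+ 4))%R)
  (hdp : (d.+2 <= p)%N)
  (dsp : measure_display) (Omega : measurableType dsp) (P : probability Omega R)
  (X : {set 'I_p} -> 'I_n -> Omega -> config p)
  (HX : forall K : {set 'I_p}, (#|K| <= moment_order d)%N ->
          iid_samples P (X K) (ising_mu th h))
  (u : 'I_p) :
  ((1 - delta)%:E <=
     P [set w | forall v : 'I_p, v != u ->
          (`|alg1_output d gamma eta T (emp_moments R X w) u v - th u v| <= eps)%R])%E.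
Proof.
pose t := eps ^+ 2 / (8 * gamma * (1 + gamma) * expR gamma ^+ 4).
have t0 : 0 <= t.
  apply: divr_ge0; first exact: sqr_ge0.
  apply: mulr_ge0; last exact/exprn_ge0/expR_ge0.
  by apply: mulr_ge0; [rewrite mulr_ge0 // ltW | rewrite addr_ge0 // ltW].
have [n0 Hcard] : (0 < n)%N /\
  (#|[set K : {set 'I_p} | (#|K| <= moment_order d)%N]%SET|)%:R
    * (2 * expR (- (n%:R * t ^+ 2 / 2))) <= delta.
  apply: sample_size_bound => //; first exact: expR_gt0.
  by have := le_nat_ceil Hn; rewrite expRM_natl.
pose small (K : {set 'I_p}) := (#|K| <= moment_order d)%N.
pose bad K := [set w | t < `|emp_moments R X w K - \sum_s ising_mu th h s * sigmaK R K s|].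
have Hbad K : small K -> measurable (bad K) /\
    (P (bad K) <= (2 * expR (- (n%:R * t ^+ 2 / 2)))%:E)%E.
  move=> sK; have mu0 s : 0 <= ising_mu th h s by apply/ltW/ising_mu_gt0.
  exact: (emp_moment_deviation mu0 (ising_mu_sum th h) n0 t0 (HX K sK)).
have [mU PU] := finite_union_bound P (fun K sK => proj1 (Hbad K sK)).
set U := [set w | _] in mU PU.
have PUd : (P U <= delta%:E)%E.
  apply: le_trans PU _.
  apply: (@le_trans _ _ (\sum_(K | small K) (2 * expR (- (n%:R * t ^+ 2 / 2)))%:E)%E).
    by apply: lee_sum => K sK; exact: (proj2 (Hbad K sK)).
  rewrite sumEFin lee_fin; apply: le_trans Hcard.
  rewrite [leRHS]mulr_natl -[leRHS]sumr_const le_eqVlt; apply/orP; left; apply/eqP.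
  by apply: eq_bigl => K; rewrite inE.
set E := [set w | _].
(* Monotonicity of the measure requires this; [E] depends only on the finitely many samples that the
   algorithm reads. *)
have mE : measurable E.
  (* Larger sets receive a constant configuration, as their samples need not be measurable. *)
  pose F (Kj : {set 'I_p} * 'I_n) w := if small Kj.1 then X Kj.1 Kj.2 w else [ffun=> true].
  have mF Kj s : measurable (F Kj @^-1` [set s]).
    have [sK|sK] := boolP (small Kj.1).
      have -> : F Kj = X Kj.1 Kj.2 by apply/funext => w; rewrite /F sK.
      exact: (proj1 (HX _ sK)).
    have -> : F Kj = cst [ffun=> true] by apply/funext => w; rewrite /F (negbTE sK).
    have [->|sn] := eqVneq s [ffun=> true].
      by rewrite (_ : _ @^-1` _ = setT) //; apply/seteqP.
    rewrite (_ : _ @^-1` _ = set0) //; apply/seteqP; split => // w /= /esym/eqP.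
    by rewrite (negbTE sn).
  pose A := [set g : {ffun {set 'I_p} * 'I_n -> config p} | forall v : 'I_p, v != u ->
    `|alg1_output d gamma eta T (emp_moments R (fun K j g => g (K, j)) g) u v - th u v| <= eps].
  rewrite (_ : E = [set w | A [ffun i => F i w]]); first exact: measurable_ffun_preimage.
  have Eout w : alg1_output d gamma eta T
     (emp_moments R (fun K j g => g (K, j)) [ffun i => F i w]) u =
     alg1_output d gamma eta T (emp_moments R X w) u.
    apply: alg1_output_ext => K sK; congr (_ * _); apply: eq_bigr => j _.
    by rewrite ffunE /F /small sK.
  by apply/seteqP; split => w; rewrite /E /A /= Eout.
(* Outside [U] every required moment is accurate to within [t], so [E] contains its complement, of
   probability at least 1 - delta. One good event serves all [v] at once. *)
apply: (@le_trans _ _ (P (~` U))).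
  rewrite probability_setC //.
  have [r rP] : exists r, P U = r%:E.
    by exists (fine (P U)); rewrite fineK // fin_num_measure.
  by move: PUd; rewrite rP -EFinB !lee_fin lerD2l lerN2.
apply: le_measure; rewrite ?inE //; first exact: measurableC.
move=> w Uw v vu.
apply: (alg1_accuracy (th := th) (h := h) hsym hwidth hgamma heps heps4) => //.
- exact: le_nat_ceil.
- by move=> K; exact: emp_moments_le1.
move=> K sK; rewrite expRM_natl leNgt; apply/negP => Kbad.
by apply: Uw; exists K.
Qed.
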